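(* Let $EP \in e\mathcal{MPGN}4$. Suppose $EP$ contains distinct vertices $a,b,v_1,v_2,v_4,v_5,c,d,u_1,u_2,u_3,u_4,u_5,u_6$ such that each of $a,b,v_1,v_2,v_4,v_5$ has degree $5$ with neighbourhoods $N(a)=\{b,c,d,v_1,v_2\}$, $N(b)=\{a,c,d,v_4,v_5\}$, $N(v_1)=\{a,v_2,d,u_1,u_2\}$, $N(v_2)=\{a,v_1,c,u_2,u_3\}$, $N(v_4)=\{b,v_5,c,u_4,u_5\}$, $N(v_5)=\{b,v_4,d,u_5,u_6\}$, so that these six degree-5 vertices form a ''dumbbell'' (the adjacent pair $a,b$ together with the triangles $av_1v_2$ and $bv_4v_5$) whose surrounding cycle of neighbours is $d$-$u_1$-$u_2$-$u_3$-$c$-$u_4$-$u_5$-$u_6$-$d$. Then $\deg(c)\ge 8$ and $\deg(d)\ge 8$.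
   Context: All graphs are simple and connected. A maximal planar graph (MPG) is a planar graph to which no edge joining two nonadjacent vertices can be added while keeping it planar (equivalently, for at least 3 vertices, a plane graph all of whose faces are triangles). Let $\mathcal{N}4$ be the set of all simple connected planar graphs that are not 4-colorable (in the usual proper vertex-coloring sense). Then $e\mathcal{MPGN}4$ denotes the set of graphs $EP\in\mathcal{N}4$ that are maximal planar graphs and have the minimum possible number of vertices among graphs in $\mathcal{N}4$ (i.e., minimal counterexamples to the Four Color Theorem that are MPGs). $\deg(x)$ denotes the degree of vertex $x$ and $N(x)$ its set of neighbours. *)

(* Defs.v *)
From mathcomp Require Import all_boot all_fingroup.
Set Implicit Arguments. Unset Strict Implicit. Unset Printing Implicit Defensive.

Section Graphs.
Variable T : finType.
Implicit Types (e : rel T).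

Definition simple_graph e := symmetric e /\ irreflexive e.

Definition connected_graph e := forall x y : T, connect e x y.

Definition nbhd e (x : T) : {set T} := [set y | e x y].
Definition deg e (x : T) : nat := #|nbhd e x|.

Definition dart e (d : T * T) : bool := e d.1 d.2.
Definition darts e : {set T * T} := [set d | dart e d].

Definition rotation_system e (sigma : {perm T * T}) : Prop :=
  [/\ forall d, ~~ dart e d -> sigma d = d,
      forall d, dart e d -> dart e (sigma d) /\ (sigma d).1 = d.1
    & forall d d', dart e d -> dart e d' -> d.1 = d'.1 -> fconnect sigma d d'].

Definition face_perm (sigma : {perm T * T}) (d : T * T) : T * T :=
  sigma (d.2, d.1).

Definition nfaces e (sigma : {perm T * T}) : nat :=
  #|[set d | dart e d & froot (face_perm sigma) d == d]|.

(* Planarity (Heffter--Edmonds / combinatorial embeddings): a graph with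
   no edges is planar; a graph with at least one edge is planar iff it has a
   rotation system satisfying Euler's formula V - E + F = 2
   (written with E = #darts/2, multiplied by 2 to stay in nat).
   This characterization is intended (and only used) for connected graphs. *)
Definition planar e : Prop :=
  #|darts e| = 0 \/
  exists sigma : {perm T * T}, rotation_system e sigma /\
    (2 * #|T| + 2 * nfaces e sigma = 4 + #|darts e|)%N.

Definition add_edge e (x y : T) : rel T :=
  fun u v => e u v || ((u == x) && (v == y)) || ((u == y) && (v == x)).

Definition maximal_planar e : Prop :=
  planar e /\ forall x y : T, x != y -> ~~ e x y -> ~ planar (add_edge e x y).

Definition four_colorable e : Prop :=
  exists c : T -> 'I_4, forall x y, e x y -> c x != c y.

End Graphs.

Definition in_N4 (T : finType) (e : rel T) : Prop :=
  [/\ simple_graph e, connected_graph e, planar e & ~ four_colorable e].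

Definition in_eMPGN4 (T : finType) (e : rel T) : Prop :=
  [/\ in_N4 e, maximal_planar e &
      forall (T' : finType) (e' : rel T'), in_N4 e' -> (#|T| <= #|T'|)%N].

(* Main.v *)
Require Import Defs.
From mathcomp Require Import all_boot all_fingroup zify.
Set Implicit Arguments. Unset Strict Implicit. Unset Printing Implicit Defensive.

(** By symmetry it suffices to bound [deg c], and [c] has the six neighbours
    [a, b, v2, v4, u3, u4]. Let the interior be [a, b, v1, v2, v4, v5, c].

    If [deg c = 6], contract [{d, a, c}], [{u1, v1, v2}] and [{u4, b, v4, v5}]. The
    quotient is planar, hence 4-colourable by minimality, and every colouring of
    it extends to the interior.

    If [deg c = 7], with seventh neighbour [x], contract [{d, u5, a, v5}],
    [{u1, v1}], [{u3, v2}] and [{x, b, c, v4}]. Up to renaming, only one ring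
    colouring does not extend, namely [0 1 2 3 1 2 0 2] on
    [d u1 u2 u3 x u4 u5 u6], and at most two Kempe interchanges repair it.

    Planarity enters in three ways. Contracting connected fibres preserves it,
    because contracting an edge preserves Euler's formula, and by the Euler
    inequality so does deleting an edge without disconnecting the map. Kempe
    chains cannot cross outside the ring, because otherwise the interior and four
    arcs of the ring would give a [K5] minor. Finally, an edge can be drawn in a
    corner, so consecutive neighbours of a vertex of a maximal planar graph are
    adjacent. *)

Local Open Scope group_scope.

(** * Permutation maps and Euler's formula *)

(** The interior meets the rest of the graph only in the ring, which has seven vertices when
    [deg c = 6] and eight when [deg c = 7]. A contraction pays twice: the quotient is smaller, and
    every edge between two classes forces an inequality of ring colours beyond those of the ring
    edges. What remains is small enough to be settled by computation.

    Identifying [d] with [u5] requires them to be nonadjacent, and the Kempe argument requires the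
    eight ring vertices to be distinct, although nothing given prevents [x] from being one of the
    others. Nonadjacency, and part of the distinctness, come from the absence of separating
    triangles, which forbids chords in the neighbourhood of a vertex of degree 5. The coincidence
    [x = u1] escapes this and is handled by reflecting the dumbbell so that [a] and [b] are
    exchanged.

    A drawing is a pair of permutations of darts. Changing the drawing means multiplying these by
    transpositions while the type of darts stays fixed, so every change in Euler's formula is read
    off from cycle counts. *)

Definition ncycles (D : finType) (s : {perm D}) : nat := #|porbits s|.

Section Maps.
Variable D : finType.
Implicit Types (al si s : {perm D}) (A P : {set D}) (x y z d : D).

(* Rewriting with [mulgA] itself yields products that are convertible but not
   syntactically equal to the elaborated ones, which [lia] does not identify. *)
Lemma mulpA s t u : s * (t * u) = s * t * u.
Proof. exact: mulgA. Qed.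

Lemma ncycles_mul_tperm s x y :
  (ncycles (tperm x y * s) + (x \notin porbit s y).*2 = ncycles s + (x != y))%N.
Proof. exact: porbits_mul_tperm. Qed.

Lemma ncyclesV s : ncycles s^-1 = ncycles s.
Proof. by rewrite /ncycles porbitsV. Qed.

Lemma ncycles_tperm_same s x y : x != y -> x \in porbit s y ->
  ncycles (tperm x y * s) = (ncycles s).+1.
Proof. by move=> xy sxy; have := ncycles_mul_tperm s x y; rewrite /= sxy xy; lia. Qed.

Lemma ncycles_tperm_diff s x y : x \notin porbit s y ->
  (ncycles (tperm x y * s)).+1 = ncycles s.
Proof.
move=> sxy; have xy: x != y by apply: contraNneq sxy => ->; apply: porbit_id.
by have := ncycles_mul_tperm s x y; rewrite /= sxy xy; lia.
Qed.

Lemma ncycles_tpermC s x y : ncycles (s * tperm x y) = ncycles (tperm x y * s).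
Proof.
have E : s * tperm x y = (tperm x y * s^-1)^-1 by rewrite invMg invgK tpermV.
have := ncycles_mul_tperm s^-1 x y; have := ncycles_mul_tperm s x y.
by rewrite E !ncyclesV porbitV; lia.
Qed.

Lemma porbit_step s x : s x \in porbit s x.
Proof. exact: (mem_porbit s 1). Qed.

Lemma stable_porbit s P x y : {in P, forall z, s z \in P} -> x \in P ->
  y \in porbit s x -> y \in P.
Proof.
move=> sP xP /porbitP[i ->]; elim: i => [|i IH]; first by rewrite perm1.
by rewrite expgSr permM sP.
Qed.

Lemma porbit_trans s x y z :
  y \in porbit s x -> z \in porbit s y -> z \in porbit s x.
Proof. by rewrite -!eq_porbit_mem => /eqP <-. Qed.

Lemma ncycles_on A s : perm_on A s ->
  ncycles s + #|A| = #|D| + #|porbit s @: A|.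
Proof.
move=> sA; have fixN x : x \notin A -> porbit s x = [set x].
  move=> xA; apply/setP=> y; rewrite inE; apply/idP/eqP => [|->]; last exact: porbit_id.
  move=> yx; apply/set1P; apply: (stable_porbit _ _ yx); rewrite ?set11 //.
  by move=> z /set1P ->; rewrite (out_perm sA) // set11.
rewrite /ncycles; have -> : porbits s = porbit s @: A :|: porbit s @: (~: A).
  rewrite -imsetU setUCr; apply/setP => O.
  by apply/imsetP/imsetP => -[x _ ->]; exists x.
have dis : porbit s @: A :&: porbit s @: (~: A) = set0.
  apply/setP => O; rewrite !inE; apply/negP => /andP[/imsetP[x xA ->] /imsetP[y]].
  rewrite inE => yA; rewrite (fixN y) // => Oxy.
  by move: (porbit_id s x); rewrite Oxy inE => /eqP xy; rewrite -xy xA in yA.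
have cN : #|porbit s @: (~: A)| = #|~: A|.
  rewrite card_in_imset // => x y; rewrite !inE => xA yA.
  by rewrite !fixN // => /set1_inj.
by rewrite cardsU dis cards0 cN; have := cardsC A; lia.
Qed.

Definition involutive_perm al := forall x, al (al x) = x.

(** Connectivity of the map, phrased with stable sets: when the permutations change, only the set
    [P] has to be transported. *)
Definition transitive_on A al si := forall P : {set D},
  {in P, forall x, al x \in P} -> {in P, forall x, si x \in P} ->
  {in A &, forall x y, x \in P -> y \in P}.

(* Cuts the edge of [d] into two half-edges. *)
Definition detach d al : {perm D} := tperm d (al d) * al.

Lemma detachE al d x : involutive_perm al ->
  detach d al x = if (x == d) || (x == al d) then x else al x.
Proof.
move=> alK; rewrite permM; case: tpermP => [->|->|/eqP/negPf-> /eqP/negPf->] //.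
  by rewrite alK eqxx.
by rewrite eqxx orbT.
Qed.

Lemma detach_involutive al d : involutive_perm al -> involutive_perm (detach d al).
Proof.
move=> alK x; rewrite !detachE //; case: (boolP ((x == d) || (x == al d))) => [->//|] /norP[xd xad].
by rewrite -{1}[d]alK !(inj_eq perm_inj) (negPf xd) (negPf xad) alK.
Qed.

(** With the transposition on the right, it cancels against the one that merges two cycles of [si].
    This is why a contraction leaves the faces [al * si] unchanged. *)
Lemma detach_commute al d : involutive_perm al -> detach d al = al * tperm d (al d).
Proof.
move=> alK; apply/permP => x; rewrite detachE // permM.
case: eqP => [->|xd] /=; first by rewrite tpermR.
case: eqP => [->|xad]; first by rewrite alK tpermL.
rewrite tpermD //; apply/eqP => E; [apply: xad | apply: xd].
  by rewrite E alK.
exact: perm_inj (esym E).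
Qed.

Definition moved al := [set x | al x != x].

Lemma moved_detach al d : involutive_perm al -> al d != d ->
  #|moved (detach d al)| < #|moved al|.
Proof.
move=> alK dd; apply: proper_card; apply/properP; split.
  by apply/subsetP => x; rewrite !inE detachE //; case: ifP; rewrite ?eqxx.
by exists d; rewrite !inE ?detachE ?eqxx.
Qed.

Lemma ncycles_detach al d : al d != d -> ncycles (detach d al) = (ncycles al).+1.
Proof.
by move=> dd; rewrite ncycles_tperm_same 1?eq_sym // porbit_sym porbit_step.
Qed.

(** Detaching an edge adds a cycle to [al] and costs [al * si] at most one, so the left side never
    decreases; at [al = 1] the bound is trivial. *)
Lemma ncycles_mul_le al si : involutive_perm al ->
  ncycles al + ncycles (al * si) <= #|D| + ncycles si.
Proof.
have [n] := ubnP #|moved al|; elim: n => // n IH in al *; rewrite ltnS => le_n alK.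
have [al1|/set0Pn[d]] := eqVneq (moved al) set0.
  have -> : al = 1.
    apply/permP => x; rewrite perm1; apply/eqP; apply/negPn/negP => xx.
    by move/setP/(_ x): al1; rewrite !inE xx.
  by rewrite mul1g leq_add2r; apply: leq_trans (leq_imset_card _ _) _.
rewrite inE => dd.
have := IH _ (leq_trans (moved_detach alK dd) le_n) (detach_involutive d alK).
rewrite ncycles_detach // /detach -mulpA.
have := ncycles_mul_tperm (al * si) d (al d); rewrite /= eq_sym dd.
by case: (_ \in _) => /=; lia.
Qed.

Lemma porbit_tperm_merge si x y : x \notin porbit si y ->
  x \in porbit (tperm x y * si) y.
Proof.
move=> xy; have ne: x != y by apply: contraNneq xy => ->; apply: porbit_id.
have := ncycles_mul_tperm (tperm x y * si) x y; rewrite /= mulpA tperm2 mul1g.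
by have := ncycles_tperm_diff xy; rewrite ne; case: (_ \in _) => //=; lia.
Qed.

(** The product with the transposition puts [d] and [al d] on one cycle, so a stable set contains
    both or neither. It is then stable under the transposition, hence under the old permutations. *)
Lemma transitive_contract A al si d : involutive_perm al -> al d \notin porbit si d ->
  transitive_on A al si -> transitive_on A (detach d al) (tperm d (al d) * si).
Proof.
move=> alK dd tr P alP siP.
have E : (d \in P) = (al d \in P).
  have dd' : d \notin porbit si (al d) by rewrite porbit_sym.
  apply/idP/idP => dP; apply: (stable_porbit siP dP).
    by rewrite porbit_sym porbit_tperm_merge.
  by rewrite porbit_tperm_merge.
have tP x : x \in P -> tperm d (al d) x \in P.
  by case: tpermP => [->|->|//]; rewrite E.
apply: tr => x xP.
  by have := alP _ (tP _ xP); rewrite permM tpermK.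
by have := siP _ (tP _ xP); rewrite permM tpermK.
Qed.

(** Contracting an edge between two vertices trades a cycle of [si] for one of [al] and keeps the
    faces. When no such edge is left, transitivity leaves a single cycle of [si] on [A], and
    [ncycles_mul_le] bounds the number of faces. *)
Lemma euler_le A al si : perm_on A al -> perm_on A si -> involutive_perm al ->
  transitive_on A al si -> A != set0 ->
  (ncycles al + ncycles si + ncycles (al * si) + 2 * #|A| <= 3 * #|D| + 2)%N.
Proof.
have [n] := ubnP #|moved al|; elim: n => // n IH in al si *.
rewrite ltnS => le_n alA siA alK tr A0.
have alP x : x \in A -> al x \in A by rewrite perm_closed.
case: (pickP [pred d | (d \in A) && (al d \notin porbit si d)]) => [d /andP[dA dd]|noc].
  have ne : al d != d by apply: contraNneq dd => ->; apply: porbit_id.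
  have tA : perm_on A (tperm d (al d)).
    by apply: subset_trans (tperm_on _ _) _; apply/subsetP => x /set2P[]->; rewrite ?alP.
  have := IH (detach d al) (tperm d (al d) * si) (leq_trans (moved_detach alK ne) le_n).
  move/(_ (perm_onM tA alA) (perm_onM tA siA) (detach_involutive d alK)).
  move/(_ (transitive_contract alK dd tr) A0).
  rewrite {2}detach_commute // -mulpA (mulpA (tperm _ _)) tperm2 mul1g ncycles_detach //.
  have := @ncycles_tperm_diff si d (al d); rewrite porbit_sym => /(_ dd); lia.
have [x0 x0A] := set0Pn _ A0.
have one : #|porbit si @: A| = 1%N.
  apply/eqP/cards1P; exists (porbit si x0); apply/setP => O; rewrite inE.
  apply/imsetP/eqP => [[x xA ->]|->]; last by exists x0.
  apply/eqP; rewrite eq_porbit_mem; apply: (tr _ _ _ x0 x); rewrite ?porbit_id // => y yO.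
    apply: porbit_trans yO _; case: (boolP (y \in A)) => yA.
      by have := noc y; rewrite /= yA /= => /negbFE.
    by rewrite (out_perm alA) ?porbit_id.
  exact: porbit_trans yO (porbit_step _ _).
have := ncycles_mul_le si alK; have := ncycles_on siA; rewrite one.
by have := max_card (mem A); lia.
Qed.

(* Darts outside [A] are fixed points of both permutations; this turns
   [V - E + F = 2] for the map living on [A] into the equation below. *)
Definition euler A al si : Prop :=
  (ncycles al + ncycles si + ncycles (al * si) + 2 * #|A| = 3 * #|D| + 2)%N.

(* [al] pairs the two darts of each edge (a fixed point is a half-edge), [si] turns
   around vertices and [al * si] around faces. *)
Definition planar_map A al si :=
  [/\ perm_on A al, perm_on A si, involutive_perm al, transitive_on A al si & euler A al si].

Lemma planar_map_contract A al si d : planar_map A al si -> al d \notin porbit si d ->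
  planar_map A (detach d al) (tperm d (al d) * si).
Proof.
case=> alA siA alK tr eul dd.
have ne : al d != d by apply: contraNneq dd => ->; apply: porbit_id.
have dA : d \in A by apply: contraNT ne => dA; rewrite (out_perm alA).
have tA : perm_on A (tperm d (al d)).
  by apply: subset_trans (tperm_on _ _) _; apply/subsetP => x /set2P[]->; rewrite ?perm_closed.
split; [exact: perm_onM | exact: perm_onM | exact: detach_involutive | exact: transitive_contract |].
move: eul; rewrite /euler {2}detach_commute // -mulpA (mulpA (tperm _ _)) tperm2 mul1g ncycles_detach //.
by have := @ncycles_tperm_diff si d (al d); rewrite porbit_sym => /(_ dd); lia.
Qed.

(* By the Euler inequality, deleting an edge without disconnecting the map
   cannot split a face. *)
Lemma planar_map_detach A al si d : planar_map A al si -> al d != d ->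
  transitive_on A (detach d al) si -> planar_map A (detach d al) si.
Proof.
case=> alA siA alK tr eul ne tr'.
have dA : d \in A by apply: contraNT ne => dA; rewrite (out_perm alA).
have tA : perm_on A (tperm d (al d)).
  by apply: subset_trans (tperm_on _ _) _; apply/subsetP => x /set2P[]->; rewrite ?perm_closed.
have alA' : perm_on A (detach d al) by apply: perm_onM.
have alK' := detach_involutive d alK.
split=> //; have A0 : A != set0 by apply/set0Pn; exists d.
have E : detach d al * si = tperm d (al d) * (al * si) by rewrite mulpA.
have := euler_le alA' siA alK' tr' A0; rewrite E ncycles_detach //.
have := ncycles_mul_tperm (al * si) d (al d); rewrite eq_sym ne; move: eul; rewrite /euler E ncycles_detach //.
by case: (_ \in _) => /=; lia.
Qed.

Lemma skipE si z x :
  (si * tperm z (si z)) x = if x == z then z else if si x == z then si z else si x.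
Proof.
rewrite permM; case: eqP => [->|xz]; first by rewrite tpermR.
case: eqP => [->|xsz]; first by rewrite tpermL.
by rewrite tpermD // eq_sym ?(inj_eq perm_inj); apply/eqP.
Qed.

(** Extends a set that is stable under the shortened cycle: [z] takes the membership of its
    successor. *)
Lemma skip_stable si z (P : {set D}) :
  {in P, forall x, (si * tperm z (si z)) x \in P} -> si z != z ->
  {in [set w | if w == z then si z \in P else w \in P],
    forall x, si x \in [set w | if w == z then si z \in P else w \in P]}.
Proof.
move=> sP nz x; rewrite !inE; case: (eqVneq x z) => [-> zP|xz xP].
  by rewrite (negPf nz).
by have := sP x xP; rewrite skipE (negPf xz); case: eqP.
Qed.

(** Skipping the half-edge turns it into a fixed point of both [si] and [al * si]. The two new
    cycles balance the loss of one dart in [2 * #|A|]. *)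
Lemma planar_map_remove A al si z : planar_map A al si -> z \in A -> al z = z ->
  si z != z -> planar_map (A :\ z) al (si * tperm z (si z)).
Proof.
case=> alA siA alK tr eul zA alz siz.
have alA' : perm_on (A :\ z) al.
  apply/subsetP => x; rewrite !inE => xx; apply/andP; split.
    by apply: contraNneq xx => ->; rewrite alz.
  by apply: contraNT xx => xA; rewrite (out_perm alA).
split=> //.
- apply/subsetP => x; rewrite !inE skipE => xx; apply/andP; split.
    by apply: contraNneq xx => ->; rewrite eqxx.
  apply: contraNT xx => xA; have /negPf xz : x != z by apply: contraNneq xA => ->.
  by rewrite (out_perm siA) // xz.
- move=> P alP siP x y /setD1P[xz xA] /setD1P[yz yA] xP.
  have := tr [set w | if w == z then si z \in P else w \in P] _ (skip_stable siP siz) x y xA yA.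
  rewrite !inE (negPf xz) (negPf yz); apply => // w; rewrite !inE.
  case: (eqVneq w z) => [->|wz wP]; first by rewrite alz eqxx.
  by rewrite -{1}alz (inj_eq perm_inj) (negPf wz) alP.
- have alsz : (al * si) z = si z by rewrite permM alz.
  have E s : s z != z -> ncycles (s * tperm z (s z)) = (ncycles s).+1.
    move=> sz; rewrite ncycles_tpermC ncycles_tperm_same 1?eq_sym //.
    by rewrite porbit_sym porbit_step.
  move: eul; rewrite /euler E // mulpA -alsz E ?alsz //; have := cardsD1 z A; rewrite zA; lia.
Qed.

Lemma porbit_skip si z x y : si z != z -> x != z -> y != z ->
  (y \in porbit (si * tperm z (si z)) x) = (y \in porbit si x).
Proof.
move=> siz xz yz; apply/idP/idP => [|yx].
  apply: stable_porbit (porbit_id _ _) => w wx; apply: porbit_trans wx _.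
  rewrite skipE; case: eqP => [->|_]; first exact: porbit_id.
  case: eqP => [<-|_]; last exact: porbit_step.
  exact: porbit_trans (porbit_step _ _) (porbit_step _ _).
have st : {in porbit (si * tperm z (si z)) x, forall w,
    (si * tperm z (si z)) w \in porbit (si * tperm z (si z)) x}.
  by move=> w wx; apply: porbit_trans wx (porbit_step _ _).
have := stable_porbit (skip_stable st siz) _ yx.
by rewrite !inE (negPf xz) (negPf yz) porbit_id; apply.
Qed.

(** Contracted and deleted edges survive as fixed points of [al]. Their removal leaves a map whose
    darts all belong to edges, as a rotation system requires. *)
Lemma planar_map_strip A al si : planar_map A al si -> (exists d, al d != d) ->
  exists2 si', planar_map (moved al) al si' &
    {in moved al &, forall x y, (y \in porbit si' x) = (y \in porbit si x)}.
Proof.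
have [n] := ubnP #|A|; elim: n => // n IH in A si *; rewrite ltnS => le_n pm [d dd].
have [alA _ _ tr _] := pm.
have dA : d \in A by apply: contraNT dd => dA; rewrite (out_perm alA).
have sub : moved al \subset A.
  by apply/subsetP => x; rewrite inE; apply: contraNT => xA; rewrite (out_perm alA).
have [E|ne] := eqVneq (moved al) A; first by exists si; rewrite ?E.
have [z zA] : exists2 z, z \in A & z \notin moved al.
  by apply/subsetPn; apply: contra ne => sub'; rewrite eqEsubset sub.
rewrite inE negbK => /eqP alz.
(* A half-edge alone at its vertex would be a component by itself, whereas [A] also contains [d]. *)
have siz : si z != z.
  apply/eqP => siz; have := tr [set z] _ _ z d zA dA (set11 z).
  rewrite inE => dz; suff /eqP dz' : d == z by rewrite dz' alz eqxx in dd.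
  by apply: dz => x /set1P ->; rewrite ?alz ?siz set11.
have lt_n : #|A :\ z| < n by have := cardsD1 z A; rewrite zA; lia.
have [si' pm' E] := IH _ _ lt_n (planar_map_remove pm zA alz siz) (ex_intro _ d dd).
exists si' => // x y xm ym; rewrite E // porbit_skip //.
  by apply: contraTneq xm => ->; rewrite inE alz eqxx.
by apply: contraTneq ym => ->; rewrite inE alz eqxx.
Qed.
End Maps.

(** * Rotation systems *)


Lemma moved_detachE (D : finType) (al : {perm D}) (d : D) : involutive_perm al ->
  moved al :\ d :\ al d = moved (detach d al).
Proof.
move=> alK; apply/setP => x; rewrite !inE detachE //.
by case: eqP => [->|_]; case: eqP => [->|_]; rewrite ?eqxx.
Qed.

Lemma ncycles_involutive (D : finType) (al : {perm D}) : involutive_perm al ->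
  (2 * ncycles al + #|moved al| = 2 * #|D|)%N.
Proof.
have [n] := ubnP #|moved al|; elim: n => // n IH in al *; rewrite ltnS => le_n alK.
have [al1|/set0Pn[d]] := eqVneq (moved al) set0.
  have -> : al = 1.
    apply/permP => x; rewrite perm1; apply/eqP; apply/negPn/negP => xx.
    by move/setP/(_ x): al1; rewrite !inE xx.
  rewrite /ncycles; have := @ncycles_on _ set0 (1 : {perm D}) (perm_on1 _).
  rewrite imset0 !cards0 !addn0 /ncycles => ->.
  by rewrite (_ : moved _ = set0) ?cards0 ?addn0 //; apply/setP => x; rewrite !inE perm1 eqxx.
rewrite inE => dd.
have := IH _ (leq_trans (moved_detach alK dd) le_n) (detach_involutive d alK).
rewrite ncycles_detach // -moved_detachE //.
have := cardsD1 d (moved al); have := cardsD1 (al d) (moved al :\ d).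
by rewrite !inE dd alK [d == _]eq_sym dd /=; lia.
Qed.

Lemma eulerE (D : finType) (A : {set D}) (al si : {perm D}) :
  involutive_perm al -> moved al = A -> perm_on A si ->
  euler A al si <->
    (2 * #|porbit si @: A| + 2 * #|porbit (al * si) @: A| = 4 + #|A|)%N.
Proof.
move=> alK alA siA; have phiA : perm_on A (al * si).
  by apply: perm_onM => //; rewrite -alA; apply/subsetP => x; rewrite !inE.
have := ncycles_involutive alK; have := ncycles_on siA; have := ncycles_on phiA.
by rewrite alA /euler; split; lia.
Qed.

Lemma nfaces_card (T : finType) (e : rel T) (sigma : {perm T * T})
    (D : finType) (A : {set D}) (phi : {perm D}) (h : D -> T * T) :
  {in A &, injective h} -> h @: A = darts e -> {in A, forall z, phi z \in A} ->
  {in A, forall z, face_perm sigma (h z) = h (phi z)} ->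
  nfaces e sigma = #|porbit phi @: A|.
Proof.
move=> hI hA phiA hphi; set f := face_perm sigma.
have fI : injective f by move=> [a b] [a' b'] /perm_inj [-> ->].
have hit i z : z \in A -> (iter i f (h z) = h ((phi ^+ i) z)) /\ (phi ^+ i) z \in A.
  move=> zA; elim: i => [|i [IH1 IH2]]; first by rewrite perm1.
  by rewrite iterS IH1 expgSr permM; split; [exact: hphi | exact: phiA].
have hcon z w : z \in A -> w \in porbit phi z -> fconnect f (h z) (h w).
  by move=> zA /porbitP[i ->]; rewrite -(hit i z zA).1 fconnect_iter.
pose G t := if [pick z in A | h z == t] is Some z then porbit phi z else set0.
have GE z : z \in A -> G (h z) = porbit phi z.
  move=> zA; rewrite /G; case: pickP => [w /andP[wA /eqP/hI->]|/(_ z)] //.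
  by rewrite zA eqxx.
have dartsP t : dart e t -> exists2 z, z \in A & t = h z.
  by move=> et; apply/imsetP; rewrite hA inE.
have dartsA z : z \in A -> dart e (h z).
  by move=> zA; have := imset_f h zA; rewrite hA inE.
rewrite /nfaces -(card_in_imset (f := G)); last first.
  move=> t u; rewrite !inE => /andP[/dartsP[z zA ->] /eqP rz] /andP[/dartsP[w wA ->] /eqP rw].
  rewrite !GE // => zw; rewrite -rz -rw; apply/eqP; rewrite root_connect; last exact: fconnect_sym.
  by apply: hcon => //; rewrite zw porbit_id.
congr #|pred_of_set _|; apply/setP => O; apply/imsetP/imsetP => [[t]|[z zA ->]].
  by rewrite inE => /andP[/dartsP[z zA ->] _] ->; exists z; rewrite ?GE.
have [i iz] : exists i, iter i f (h z) = froot f (h z).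
  by exists (findex f (h z) (froot f (h z))); rewrite iter_findex ?connect_root.
have [E iA] := hit i z zA; exists (froot f (h z)).
  by rewrite inE -{1}iz E dartsA //= (root_root (fconnect_sym fI)).
by rewrite -iz E GE // porbit_perm.
Qed.

Lemma vertices_card (T D : finType) (A : {set D}) (si : {perm D}) (tl : D -> T) :
  {in A &, forall z w, (w \in porbit si z) = (tl z == tl w)} ->
  (forall v, exists2 z, z \in A & tl z = v) -> #|porbit si @: A| = #|T|.
Proof.
move=> siE tlA; pose G v := if [pick z in A | tl z == v] is Some z then porbit si z else set0.
have GE z : z \in A -> G (tl z) = porbit si z.
  move=> zA; rewrite /G; case: pickP => [w /andP[wA /eqP wz]|/(_ z)]; last by rewrite zA eqxx.
  by apply/eqP; rewrite eq_porbit_mem siE // wz.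
have -> : porbit si @: A = [set G v | v in T].
  apply/setP => O; apply/imsetP/imsetP => [[z zA ->]|[v _ ->]].
    by exists (tl z); rewrite ?GE.
  by have [z zA <-] := tlA v; exists z; rewrite ?GE.
apply: card_imset => u v; have [z zA <-] := tlA u; have [w wA <-] := tlA v.
by rewrite !GE // => /eqP; rewrite eq_porbit_mem siE // => /eqP.
Qed.

(** The labelling [h] allows [D] to consist of the darts of another graph, of which [e] is only a
    quotient. *)
Lemma planar_of_map (T : finType) (e : rel T) (D : finType) (A : {set D})
    (al si : {perm D}) (h : D -> T * T) :
  involutive_perm al -> moved al = A -> perm_on A si -> euler A al si ->
  {in A &, injective h} -> h @: A = darts e ->
  {in A, forall z, h (al z) = ((h z).2, (h z).1)} ->
  {in A &, forall z w, (w \in porbit si z) = ((h z).1 == (h w).1)} ->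
  (forall v, exists2 z, z \in A & (h z).1 = v) -> planar e.
Proof.
move=> alK alA siA eul hI hA hal hsi hv; right.
have dartsP t : dart e t -> exists2 z, z \in A & t = h z.
  by move=> et; apply/imsetP; rewrite hA inE.
have dartsA z : z \in A -> dart e (h z).
  by move=> zA; have := imset_f h zA; rewrite hA inE.
(* The rotation is [si] transported along [h], and the identity off the darts of [e]. *)
pose G t := if [pick z in A | h z == t] is Some z then h (si z) else t.
have GE z : z \in A -> G (h z) = h (si z).
  move=> zA; rewrite /G; case: pickP => [w /andP[wA /eqP/hI->]|/(_ z)] //.
  by rewrite zA eqxx.
have GN t : ~~ dart e t -> G t = t.
  rewrite /G => et; case: pickP => // z /andP[zA /eqP zt].
  by rewrite -zt dartsA in et.
have siAP z : z \in A -> si z \in A by rewrite perm_closed.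
have alAP z : z \in A -> al z \in A.
  by rewrite -alA !inE alK eq_sym.
have GI : injective G.
  move=> t u; case: (boolP (dart e t)) => [/dartsP[z zA ->]|et];
  case: (boolP (dart e u)) => [/dartsP[w wA ->]|eu].
  - by rewrite !GE // => /hI H; congr h; apply: (@perm_inj _ si); rewrite H ?siAP.
  - by rewrite GE // (GN u) // => E; rewrite -E dartsA ?siAP in eu.
  - by rewrite GE // (GN t) // => E; rewrite E dartsA ?siAP in et.
  - by rewrite !GN.
exists (perm GI); split.
  split=> [t et|t|t u].
  - by rewrite permE GN.
  - case/dartsP=> z zA ->; rewrite permE GE // dartsA ?siAP //; split=> //.
    by apply/esym/eqP; rewrite -hsi ?siAP // porbit_step.
  - case/dartsP=> z zA -> /dartsP[w wA ->] /eqP; rewrite -hsi // => /porbitP[i ->].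
    have -> : h ((si ^+ i) z) = iter i (perm GI) (h z).
      elim: i => [|i IH]; first by rewrite perm1.
      rewrite iterS -IH expgSr permM permE GE //.
      by elim: i {IH} => [|i IH]; rewrite ?perm1 // expgSr permM siAP.
    exact: fconnect_iter.
rewrite (@nfaces_card _ _ _ _ A (al * si) h) //; first last.
- by move=> z zA; rewrite /face_perm permE -hal // GE ?alAP // permM.
- by move=> z zA; rewrite permM siAP ?alAP.
have cA : #|darts e| = #|A| by rewrite -hA card_in_imset.
by rewrite -(vertices_card hsi hv) cA; apply/eulerE.
Qed.

(** The edge rules out the edgeless alternative of [planar]. Together with connectivity it gives
    every vertex a dart, so that the cycles of [si] count the vertices. *)
Lemma map_of_planar (T : finType) (e : rel T) x0 y0 :
  simple_graph e -> connected_graph e -> planar e -> e x0 y0 ->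
  exists al si : {perm T * T}, [/\ planar_map (darts e) al si,
    moved al = darts e, {in darts e, forall z, al z = (z.2, z.1)} &
    {in darts e &, forall z w, (w \in porbit si z) = (z.1 == w.1)}].
Proof.
move=> [esym eirr] con pl e0.
case: pl => [/eqP|[si [[siN siD siO] eul]]].
  by rewrite cards_eq0 => /eqP/setP/(_ (x0, y0)); rewrite !inE /dart /= e0.
pose G (t : T * T) := if dart e t then (t.2, t.1) else t.
have GK : involutive G.
  move=> [x y]; rewrite /G /dart /=; case: (boolP (e x y)) => [|/negPf] exy /=.
    by rewrite esym exy.
  by rewrite exy.
pose al := perm (can_inj GK); have alK : involutive_perm al by move=> x; rewrite !permE GK.
have alE : {in darts e, forall z, al z = (z.2, z.1)}.
  by move=> z; rewrite inE permE /G => ->.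
have mvE : moved al = darts e.
  apply/setP => -[x y]; rewrite !inE permE /G /dart /=; case: ifP => exy; last by rewrite eqxx.
  by apply/eqP => -[xy _]; rewrite xy eirr in exy.
have alA : perm_on (darts e) al by rewrite -mvE; apply/subsetP => x; rewrite !inE.
have siA : perm_on (darts e) si.
  by apply/subsetP => x; rewrite !inE; apply: contraNT => /siN->.
have siAP z : z \in darts e -> si z \in darts e by rewrite perm_closed.
have alAP z : z \in darts e -> al z \in darts e by rewrite perm_closed.
have siO' : {in darts e &, forall z w, (w \in porbit si z) = (z.1 == w.1)}.
  move=> z w zA wA; apply/idP/eqP => [/porbitP[i ->]|zw].
    suff: (si ^+ i) z \in darts e /\ ((si ^+ i) z).1 = z.1 by case.
    elim: i => [|i [IH1 IH2]]; rewrite ?perm1 // expgSr permM.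
    by move: IH1; rewrite !inE => /siD[IH3 ->].
  move: zA wA; rewrite !inE => zA wA; have := siO _ _ zA wA zw.
  by move/iter_findex <-; rewrite -permX mem_porbit.
have hasdart v : exists2 z, z \in darts e & z.1 = v.
  have [->|vx] := eqVneq v x0; first by exists (x0, y0); rewrite ?inE.
  case/connectP: (con v x0) => -[/= _ xv|w p /= /andP[evw _] _].
    by rewrite xv eqxx in vx.
  by exists (v, w); rewrite ?inE.
exists al, si; split => //; split => //.
- move=> P alP siP [x x'] [y y'] xA yA xP.
  have step v w w' : (v, w) \in P -> e v w -> e v w' -> (v, w') \in P.
    move=> vP vw vw'; apply: (stable_porbit siP vP).
    by rewrite siO' ?inE.
  case/connectP: (con x y) => p; elim: p x x' xA xP => [|v p IH] x x' xA xP /=.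
    by move: xA yA; rewrite !inE => xA yA _ xy; move: yA; rewrite xy; apply: step xP _.
  case/andP=> xv pth lst; apply: (IH v x) => //; first by rewrite inE /dart /= esym.
  have xvP : (x, v) \in P by apply: step xP _ xv; rewrite inE in xA.
  by have := alP _ xvP; rewrite alE ?inE.
apply/(eulerE alK mvE siA); rewrite (@vertices_card _ _ _ _ (@fst T T) siO' hasdart).
rewrite -(@nfaces_card T e si _ (darts e) (al * si) id) ?imset_id //.
  by move=> z zA; rewrite permM siAP ?alAP.
by move=> z zA; rewrite /face_perm permM alE.
Qed.

(** * Contractions *)

Section MoreMaps.
Variable D : finType.
Implicit Types (al si s : {perm D}) (A P : {set D}) (x y z d : D).

Lemma porbit_mergeR s x y : x \notin porbit s y -> x \in porbit (s * tperm x y) y.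
Proof.
move=> xy; rewrite -porbitV invMg tpermV; apply: porbit_tperm_merge.
by rewrite porbitV.
Qed.

Lemma porbit_subL s x y u v : x \notin porbit s y -> v \in porbit s u ->
  v \in porbit (tperm x y * s) u.
Proof.
move=> xy; apply: stable_porbit (porbit_id _ _) => w wu.
have := porbit_tperm_merge xy; set s' := _ * s => yx.
have -> : s w = s' (tperm x y w) by rewrite permM tpermK.
apply: porbit_trans (porbit_step _ _); apply: porbit_trans wu _.
by case: tpermP => [->|->|_ _]; rewrite ?porbit_id // porbit_sym.
Qed.

Lemma porbit_subR s x y u v : x \notin porbit s y -> v \in porbit s u ->
  v \in porbit (s * tperm x y) u.
Proof.
move=> xy vu; rewrite -porbitV invMg tpermV.
by apply: porbit_subL; rewrite ?porbitV.
Qed.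
End MoreMaps.

Definition quotient_graph (T T' : finType) (e : rel T) (phi : T -> T') : rel T' :=
  [rel u v | (u != v) && [exists x, exists y, [&& e x y, phi x == u & phi y == v]]].

Lemma quotient_graphP (T T' : finType) (e : rel T) (phi : T -> T') u v :
  reflect (u != v /\ exists x y, [/\ e x y, phi x = u & phi y = v]) (quotient_graph e phi u v).
Proof.
apply: (iffP andP) => -[uv].
  by case/existsP=> x /existsP[y /and3P[exy /eqP xu /eqP yv]]; split=> //; exists x, y.
case=> x [y [exy xu yv]]; split=> //; apply/existsP; exists x; apply/existsP; exists y.
by rewrite exy xu yv !eqxx.
Qed.

Lemma quotient_simple (T T' : finType) (e : rel T) (phi : T -> T') :
  symmetric e -> simple_graph (quotient_graph e phi).
Proof.
move=> esym; split=> [u v|u]; last by apply/quotient_graphP; rewrite eqxx => -[].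
by apply/quotient_graphP/quotient_graphP => -[uv [x [y [exy xu yv]]]];
  (split; [by rewrite eq_sym | exists y, x; rewrite esym]).
Qed.

Lemma quotient_connected (T T' : finType) (e : rel T) (phi : T -> T') :
  connected_graph e -> (forall u, exists x, phi x = u) ->
  connected_graph (quotient_graph e phi).
Proof.
move=> con sur u v; have [x <-] := sur u; have [y <-] := sur v.
case/connectP: (con x y) => p; elim: p x => [|z p IH] x /=; first by move=> _ ->.
case/andP=> xz pth lst; apply: connect_trans (IH z pth lst).
have [->|ne] := eqVneq (phi x) (phi z); first exact: connect0.
by apply/connect1/quotient_graphP; split=> //; exists x, z.
Qed.

Lemma exit_edge (T : finType) (e : rel T) (P : pred T) x y :
  connect e x y -> P x -> ~~ P y -> exists u v, [/\ e u v, P u & ~~ P v].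
Proof.
case/connectP=> p; elim: p x => [|z p IH] x /=; first by move=> _ -> ->.
case/andP=> xz pth lst Px Py; case: (boolP (P z)) => Pz; last by exists x, z.
exact: IH pth lst Pz Py.
Qed.

Definition fibre_rel (T T' : finType) (e : rel T) (phi : T -> T') : rel T :=
  [rel u v | e u v && (phi u == phi v)].

Definition connected_fibres (T T' : finType) (e : rel T) (phi : T -> T') : Prop :=
  forall x y, phi x = phi y -> connect (fibre_rel e phi) x y.

Section Contraction.
Variables (T T' : finType) (e : rel T) (phi : T -> T').
Hypothesis esym : symmetric e.
Hypothesis fib : connected_fibres e phi.

Let A := darts e.
Let rev (z : T * T) := (z.2, z.1).

Let revA z : z \in A -> rev z \in A.
Proof. by rewrite !inE /dart /= esym. Qed.

(* Contracted edges are kept as pairs of half-edges at the merged vertex. *)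
Let partial (al si : {perm T * T}) :=
  [/\ planar_map A al si,
      {in A, forall z, al z = rev z \/
         [/\ al z = z, phi z.1 = phi z.2 & rev z \in porbit si z]},
      {in A &, forall z w, w \in porbit si z -> phi z.1 = phi w.1} &
      {in A &, forall z w, z.1 = w.1 -> w \in porbit si z}].

(** Edges inside a fibre are contracted one at a time, as long as their ends lie on different cycles
    of [si]. A fibre edge that is never contracted has ended up as a loop. *)
Let contract_fibres al si : partial al si -> exists al' si', partial al' si' /\
  {in A, forall z, phi z.1 = phi z.2 -> rev z \in porbit si' z}.
Proof.
have [n] := ubnP #|moved al|; elim: n => // n IH in al si *; rewrite ltnS => le_n.
case=> pm ha hb hc; have [_ siA alK _ _] := pm.
case: (pickP [pred z | [&& z \in A, phi z.1 == phi z.2 & rev z \notin porbit si z]]) => [d|noc]; last first.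
  exists al, si; split=> // z zA /eqP zz; apply/negPn; apply: contraFN (noc z) => nz.
  by rewrite /= zA zz.
case/and3P=> dA /eqP dd nd.
have alE : al d = rev d by case: (ha d dA) => // -[_ _ rd]; rewrite rd in nd.
have nd' : d \notin porbit si (rev d) by rewrite porbit_sym.
have ne : al d != d by apply: contraNneq nd => E; rewrite -alE E porbit_id.
apply: (IH (detach d al) (tperm d (al d) * si)).
  exact: leq_trans (moved_detach alK ne) le_n.
split; first by apply: planar_map_contract => //; rewrite alE.
- move=> z zA; rewrite detachE // alE; case: eqP => [->|_] /=.
    by right; split=> //; rewrite porbit_sym porbit_tperm_merge.
  case: eqP => [->|_] /=.
    by right; split=> //; rewrite /rev /= -surjective_pairing porbit_tperm_merge.
  by case: (ha z zA) => [|[? ? ?]]; [left|right; split=> //; apply: porbit_subL].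
- move=> z w zA wA; rewrite alE => wz.
  suff: w \in [set w in A | phi z.1 == phi w.1] by rewrite in_set => /andP[_ /eqP].
  apply: stable_porbit wz; last by rewrite in_set zA eqxx.
  move=> x; rewrite in_set => /andP[xA /eqP xz]; rewrite in_set permM.
  suff [tA tz] : tperm d (rev d) x \in A /\ phi (tperm d (rev d) x).1 = phi z.1.
    have siP w' : w' \in A -> si w' \in A by rewrite perm_closed.
    by rewrite siP // -tz; apply/eqP/hb; rewrite ?siP ?porbit_step.
  case: tpermP => [xd|xd|//]; last by rewrite dA xz xd.
  by rewrite revA // xz xd dd.
- by move=> z w zA wA zw; rewrite alE; apply: porbit_subL => //; apply: hc.
Qed.

(** The last clause keeps a representative of every edge of the quotient while loops and parallel
    edges are deleted. *)
Let simplified (si al : {perm T * T}) :=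
  [/\ planar_map A al si,
      {in A, forall z, al z = rev z \/ al z = z} &
      {in A, forall z, phi z.1 != phi z.2 ->
        exists2 w, w \in moved al & phi w.1 = phi z.1 /\ phi w.2 = phi z.2}].

(** A loop can be deleted because both its darts lie on one cycle of [si], and one of two parallel
    edges because the other still joins the same two cycles. Transitivity therefore persists, and
    [planar_map_detach] applies. *)
Let simplify si al : {in A &, forall z w, (w \in porbit si z) = (phi z.1 == phi w.1)} ->
  simplified si al -> exists al', [/\ simplified si al',
    {in moved al', forall z, phi z.1 != phi z.2} &
    {in moved al' &, forall z w, phi z.1 = phi w.1 -> phi z.2 = phi w.2 -> z = w}].
Proof.
move=> siE; have [n] := ubnP #|moved al|; elim: n => // n IH in al *; rewrite ltnS => le_n.
case=> pm ha hf; have [alA siA alK tr _] := pm.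
have mA z : z \in moved al -> z \in A.
  by rewrite inE; apply: contraNT => zA; rewrite (out_perm alA).
have mE z : z \in moved al -> al z = rev z.
  by move=> zm; case: (ha z (mA z zm)) => // E; rewrite inE E eqxx in zm.
have mal z : z \in moved al -> al z \in moved al.
  by rewrite !inE alK eq_sym.
have step d : d \in moved al -> transitive_on A (detach d al) si ->
    {in A, forall z, phi z.1 != phi z.2 -> exists2 w, w \in moved (detach d al) &
       phi w.1 = phi z.1 /\ phi w.2 = phi z.2} ->
    exists al', [/\ simplified si al', {in moved al', forall z, phi z.1 != phi z.2} &
    {in moved al' &, forall z w, phi z.1 = phi w.1 -> phi z.2 = phi w.2 -> z = w}].
  move=> dm tr' hf'; have ne : al d != d by rewrite inE in dm.
  apply: (IH (detach d al)); first exact: leq_trans (moved_detach alK ne) le_n.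
  split=> //; first exact: planar_map_detach.
  by move=> z zA; rewrite detachE //; case: ifP => _; [right | apply: ha].
have trd d : d \in moved al ->
   (forall P : {set T * T}, {in P, forall x, detach d al x \in P} ->
      {in P, forall x, si x \in P} -> (d \in P) = (rev d \in P)) ->
   transitive_on A (detach d al) si.
  move=> dm Pd P alP siP; apply: tr => // x xP.
  have := alP x xP; rewrite detachE //; case: eqP => [->|_] /=.
    by rewrite mE // -Pd // => ->.
  case: eqP => [->|//] /=; by rewrite alK mE // => ?; rewrite Pd.
have [/existsP[d /andP[dm /eqP dd]]|noloop] :=
    boolP [exists d, (d \in moved al) && (phi d.1 == phi d.2)].
  have dA := mA d dm; apply: (step d) => //.
    apply: trd => // P _ siP.
    have dr : rev d \in porbit si d by rewrite siE ?revA //= dd.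
    by apply/idP/idP => dP; apply: (stable_porbit siP dP) => //; rewrite porbit_sym.
  move=> z zA zz; have [w wm [w1 w2]] := hf z zA zz; exists w => //.
  rewrite -moved_detachE // !inE mE //; rewrite inE in wm; rewrite wm andbT.
  by apply/andP; split; apply: contraNneq zz => wd; rewrite -w1 -w2 wd /= dd.
have nl d : d \in moved al -> phi d.1 != phi d.2.
  by move=> dm; apply: contra noloop => dd; apply/existsP; exists d; rewrite dm.
have [/existsP[d /existsP[f /and5P[dm fm df /eqP df1 /eqP df2]]]|nodup] :=
    boolP [exists d, exists f, [&& d \in moved al, f \in moved al, d != f,
      phi d.1 == phi f.1 & phi d.2 == phi f.2]]; last first.
  exists al; split=> // z w zm wm z1 z2; apply/eqP; apply: contraNT nodup => zw.
  by apply/existsP; exists z; apply/existsP; exists w; rewrite zm wm zw z1 z2 !eqxx.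
have dA := mA d dm; have fA := mA f fm; have rdA := revA dA; have rfA := revA fA.
have fd' : f != rev d by apply: contraNneq (nl d dm) => fd; rewrite df1 fd.
have frd : rev f != d by apply: contraNneq fd' => <-; rewrite /rev /= -surjective_pairing.
have rfd : rev f != rev d.
  by rewrite -(mE f fm) -(mE d dm) (inj_eq perm_inj) eq_sym.
apply: (step d) => //.
  apply: trd => // P alP siP.
  have df0 : f \in porbit si d by rewrite siE ?df1.
  have dfr : rev f \in porbit si (rev d) by rewrite siE //= df2.
  have fP : f \in P -> rev f \in P.
    by move/alP; rewrite detachE // mE // eq_sym (negPf df) (negPf fd') mE.
  have rfP : rev f \in P -> f \in P.
    by move/alP; rewrite detachE // mE // (negPf frd) (negPf rfd) -(mE f) // alK.
  apply/idP/idP => H.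
    have := fP (stable_porbit siP H df0); move/(stable_porbit siP); apply.
    by rewrite porbit_sym.
  have := rfP (stable_porbit siP H dfr); move/(stable_porbit siP); apply.
  by rewrite porbit_sym.
have fm' : f \in moved (detach d al).
  by rewrite -moved_detachE // in_setD1 in_setD1 mE // fd' [f == d]eq_sym df.
have rfm' : rev f \in moved (detach d al).
  by rewrite -moved_detachE // in_setD1 in_setD1 mE // frd rfd -(mE f) // mal.
(* If the representative was the deleted edge, its parallel [f] takes over. *)
move=> z zA zz; have [w wm [w1 w2]] := hf z zA zz.
have [wd|wd] := eqVneq w d; first by exists f => //; rewrite -df1 -df2 -wd.
have [wd'|wd'] := eqVneq w (rev d).
  by exists (rev f) => //; rewrite /= -df1 -df2 -w1 -w2 wd'.
by exists w => //; rewrite -moved_detachE // in_setD1 in_setD1 mE // wd wd'.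
Qed.

Lemma planar_quotient : irreflexive e -> connected_graph e -> planar e ->
  (forall u, exists x, phi x = u) -> planar (quotient_graph e phi).
Proof.
move=> eirr con pl sur.
have [noq|/set0Pn[[u0 v0]]] := eqVneq (darts (quotient_graph e phi)) set0.
  by left; rewrite noq cards0.
rewrite inE => /quotient_graphP[/= uv0 [x0 [y0 [e0 xu0 yv0]]]].
have [al0 [si0 [pm0 mv0 al0E si0E]]] := map_of_planar (conj esym eirr) con pl e0.
have part0 : partial al0 si0.
  split=> // [z zA|z w zA wA|z w zA wA]; first by left; apply: al0E.
    by rewrite si0E // => /eqP ->.
  by move=> zw; rewrite si0E // zw.
have [al1 [si [[pm1 ha hb hc] hd]]] := contract_fibres part0.
(* Fibre edges are now contracted or loops, so a path inside a fibre stays on one cycle of [si]; as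
   fibres are connected, cycles and fibres correspond. *)
have siE : {in A &, forall z w, (w \in porbit si z) = (phi z.1 == phi w.1)}.
  move=> z w zA wA; apply/idP/eqP => [|zw]; first exact: hb.
  case/connectP: (fib zw) => p; elim: p z zA {zw} => [|y p IH] z zA /=.
    by move=> _ lz; apply: hc; rewrite ?lz.
  case/andP=> /andP[zy /eqP pzy] pth lst.
  have zyA : (z.1, y) \in A by rewrite inE.
  apply: porbit_trans (IH (y, z.1) (revA zyA) pth lst).
  by apply: porbit_trans (hc z (z.1, y) zA zyA erefl) (hd _ zyA pzy).
have simp1 : simplified si al1.
  split=> // z zA; first by case: (ha z zA) => [|[]]; [left|right].
  move=> zz; exists z => //; rewrite inE; case: (ha z zA) => [->|[_ E _]].
    by apply: contraNneq zz => {1}<-.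
  by rewrite E eqxx in zz.
have [al [[pm al_or hf] nl inj]] := simplify siE simp1.
have [alA _ alK _ _] := pm.
have mA z : z \in moved al -> z \in A.
  by rewrite inE; apply: contraNT => zA; rewrite (out_perm alA).
have mE z : z \in moved al -> al z = rev z.
  by move=> zm; case: (al_or z (mA z zm)) => // E; rewrite inE E eqxx in zm.
have ex : exists d, al d != d.
  have [||w wm _] := hf (x0, y0); rewrite ?inE //= ?xu0 ?yv0 //.
  by exists w; rewrite inE in wm.
have [si' [_ siA' _ _ eul] siE'] := planar_map_strip pm ex.
apply: (@planar_of_map _ _ _ (moved al) al si' (fun z => (phi z.1, phi z.2))) => //.
- by move=> z w zm wm [/inj H /H ->].
- apply/setP => -[u v]; rewrite inE; apply/imsetP/quotient_graphP => /=.
    case=> z zm [-> ->]; split; first exact: nl.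
    by exists z.1, z.2; have := mA z zm; rewrite inE.
  case=> uv [x [y [exy xu yv]]]; have [||w wm [/= w1 w2]] := hf (x, y); rewrite ?inE //= ?xu ?yv //.
  by exists w => //; rewrite w1 w2 xu yv.
- by move=> z zm; rewrite mE.
- by move=> z w zm wm; rewrite siE' // siE ?mA.
- move=> u; have [x xu] := sur u.
  have [y yu] : exists y, phi y != u.
    have [E|] := eqVneq (phi x0) u; last by exists x0.
    by exists y0; rewrite -E xu0 yv0 eq_sym.
  (* Some edge leaves the fibre of [u], which gives [u] a dart. *)
  have [||a [b [eab /eqP au bu]]] := @exit_edge _ e [pred t | phi t == u] x y (con x y).
  + by rewrite /= xu.
  + exact: yu.
  have [||w wm [w1 w2]] := hf (a, b); rewrite ?inE //=; first by rewrite au eq_sym.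
  by exists w => //; rewrite w1.
Qed.
End Contraction.

(** * Drawing an edge in a corner *)

Section Insertion.
Variable D : finType.
Implicit Types (al si s : {perm D}) (A P : {set D}) (x y z w d : D).

Lemma porbit_fix s x y : s x = x -> y != x -> x \notin porbit s y.
Proof.
move=> sx; rewrite porbit_sym => /eqP yx; apply/negP => xy; case: yx; apply/set1P.
by apply: (stable_porbit _ _ xy) => [z /set1P->|]; rewrite ?sx set11.
Qed.

Lemma perm_on_tperm A x y : x \in A -> y \in A -> perm_on A (tperm x y).
Proof.
move=> xA yA; apply: subset_trans (tperm_on _ _) _.
by apply/subsetP => z /set2P[]->.
Qed.

(** The new darts are fixed points until they are spliced into the cycles before [w] and [w'], which
    costs [si] and [al * si] two cycles each. Pairing them costs [al] one cycle and, as they lie on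
    a common face, splits that face. The sum is -2 - 2 - 1 + 1 against +4 from [2 * #|A|]. *)
Lemma euler_add_edge A al si z z' w w' : perm_on A al -> perm_on A si -> involutive_perm al ->
  z \notin A -> z' \notin A -> z != z' -> w \in A -> w' \in A ->
  z \in porbit (al * (si * tperm z w * tperm z' w')) z' ->
  euler A al si -> euler (z |: (z' |: A)) (tperm z z' * al) (si * tperm z w * tperm z' w').
Proof.
move=> alA siA alK zA z'A zz' wA w'A same.
have neA x y : x \notin A -> y \in A -> y != x by move=> xA yA; apply: contraNneq xA => <-.
have fixE s x y y' : perm_on A s -> x \notin A -> y \notin A -> y' \in A -> x != y ->
    (s * tperm x y') y = y.
  by move=> sA xA yA yA' xy; rewrite permM (out_perm sA yA) tpermD // neA.
have phiA := perm_onM alA siA.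
have cnt s : perm_on A s -> ((ncycles (s * tperm z w * tperm z' w')).+2 = ncycles s)%N.
  move=> sA; rewrite ncycles_tpermC ncycles_tperm_diff; last first.
    by apply: porbit_fix; [exact: fixE | exact: neA].
  rewrite ncycles_tpermC ncycles_tperm_diff //.
  by apply: porbit_fix; [exact: out_perm sA _ | exact: neA].
have E1 : (ncycles (tperm z z' * al)).+1 = ncycles al.
  by rewrite ncycles_tperm_diff //; apply: porbit_fix; [exact: out_perm alA _ | rewrite eq_sym].
have E2 : ncycles (tperm z z' * al * (si * tperm z w * tperm z' w')) =
    (ncycles (al * (si * tperm z w * tperm z' w'))).+1.
  by rewrite -mulpA ncycles_tperm_same.
have E3 : al * (si * tperm z w * tperm z' w') = al * si * tperm z w * tperm z' w'.
  by rewrite !mulpA.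
have := cnt _ siA; have := cnt _ phiA; move: E1 E2; rewrite E3 /euler.
by rewrite !cardsU1 !inE negb_or zA z'A zz' /=; lia.
Qed.
End Insertion.

Lemma corner_edge (T : finType) (e : rel T) (al si : {perm T * T}) h p q :
  simple_graph e -> planar_map (darts e) al si -> moved al = darts e ->
  {in darts e, forall z, al z = (z.2, z.1)} ->
  {in darts e &, forall z w, (w \in porbit si z) = (z.1 == w.1)} ->
  (forall v, exists w, e v w) ->
  e h p -> e h q -> si (h, p) = (h, q) -> p != q -> ~~ e p q -> planar (add_edge e p q).
Proof.
move=> [es ei] [alA siA alK _ eul] mv alE siE hv ehp ehq hpq pq npq.
set A := darts e in alA siA eul mv alE siE.
have inA x y : ((x, y) \in A) = e x y by rewrite inE.
(* The dart [z] will come just before [(p, h)] around [p], and [z'] just after [(q, h)] around [q]: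
   these are the sides facing the corner at [h]. *)
pose z := (p, q); pose z' := (q, p); pose w := (p, h); pose w' := si (q, h).
have zA : z \notin A by rewrite inA.
have z'A : z' \notin A by rewrite inA es.
have wA : w \in A by rewrite inA es.
have siP x : x \in A -> si x \in A by rewrite perm_closed.
have w'A : w' \in A by rewrite siP // inA es.
have zz' : z != z' by apply: contraNneq pq => -[-> _].
have w'1 : w'.1 = q.
  by apply/esym/eqP; rewrite -(siE (q, h) w') ?inA ?porbit_step // es.
have neA x y : x \notin A -> y \in A -> y != x by move=> xA yA; apply: contraNneq xA => <-.
set si2 := si * tperm z w * tperm z' w'; set al2 := tperm z z' * al.
set A2 := z |: (z' |: A).
have fneq (x y : T * T) : x.1 != y.1 -> x != y by apply: contraNneq => ->.
have si2z : si2 z = w.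
  rewrite /si2 !permM (out_perm siA zA) tpermL tpermD //; first by rewrite eq_sym neA.
  by apply: fneq; rewrite w'1 eq_sym.
have si2z' : si2 z' = w'.
  rewrite /si2 !permM (out_perm siA z'A) (@tpermD _ z w) ?tpermL //; last by rewrite neA.
have hp : h != p by apply: contraTneq ehp => ->; rewrite ei.
have hq : h != q by apply: contraTneq ehq => ->; rewrite ei.
have si2w : si2 (h, p) = (h, q).
  rewrite /si2 !permM hpq (@tpermD _ z w) ?tpermD //; apply: fneq; rewrite ?w'1 eq_sym //.
have si2w' : si2 (q, h) = z'.
  rewrite /si2 !permM -/w' (@tpermD _ z w) ?tpermR //; first by rewrite eq_sym neA.
  by apply: fneq; rewrite w'1.
have alN x : x \notin A -> al x = x by move=> xA; rewrite (out_perm alA).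
have al2E x : al2 x = if x == z then z' else if x == z' then z else al x.
  rewrite permM; case: tpermP => [->|->|/eqP/negPf-> /eqP/negPf->] //.
    by rewrite eqxx alN.
  by rewrite eqxx eq_sym (negPf zz') alN.
have al2K : involutive_perm al2.
  move=> x; rewrite !al2E; case: (eqVneq x z) => [->|xz].
    by rewrite eqxx eq_sym (negPf zz').
  case: (eqVneq x z') => [->|xz']; first by rewrite eqxx.
  have alne y : y \notin A -> x != y -> al x != y.
    by move=> yA; apply: contraNneq => E; rewrite -[x]alK E alN.
  by rewrite !(negPf (alne _ _ _)) // alK.
have mv2 : moved al2 = A2.
  apply/setP => x; rewrite !in_setU1 inE al2E; case: (eqVneq x z) => [->|xz].
    by rewrite eq_sym.
  by case: (eqVneq x z') => [->|xz'] //=; rewrite -mv inE.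
have A2P x : x \in A2 -> [\/ x = z, x = z' | x \in A].
  by rewrite !in_setU1 => /or3P[/eqP|/eqP|]; [apply: Or31|apply: Or32|apply: Or33].
have AA2 x : x \in A -> x \in A2 by rewrite !in_setU1 => ->; rewrite !orbT.
have zA2 : z \in A2 by rewrite !in_setU1 eqxx.
have z'A2 : z' \in A2 by rewrite !in_setU1 eqxx orbT.
have same : z \in porbit (al * si2) z'.
  (* The three steps along the face are [z], [w], [(h, q)], [z']. *)
  rewrite porbit_sym; apply/porbitP; exists 3.
  have ph x : (al * si2) x = si2 (al x) by rewrite permM.
  by rewrite permX /= !ph (alN z) // si2z (alE w) // si2w alE ?inA // si2w'.
have siA2 : perm_on A2 si2.
  apply: perm_onM; first apply: perm_onM.
  - by apply: subset_trans siA _; apply/subsetP.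
  - by apply: perm_on_tperm => //; apply: AA2.
  - by apply: perm_on_tperm => //; apply: AA2.
have fixz : z \notin porbit si w by apply: porbit_fix; [exact: out_perm siA _ | exact: neA].
have fixz' : z' \notin porbit (si * tperm z w) w'.
  apply: porbit_fix; last by rewrite neA.
  by rewrite permM (out_perm siA) // tpermD // neA.
have sub x y : y \in porbit si x -> y \in porbit si2 x.
  by move=> yx; do 2!apply: porbit_subR => //.
have zw : z \in porbit si2 w by apply: porbit_subR => //; apply: porbit_mergeR.
have zw' : z' \in porbit si2 w' by apply: porbit_mergeR.
have near x : x \in A2 -> exists y, [/\ y \in A, y.1 = x.1 & y \in porbit si2 x].
  case/A2P=> [->|->|xA]; last by exists x; rewrite porbit_id.
    by exists w; rewrite porbit_sym.
  by exists w'; rewrite porbit_sym.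
apply: (@planar_of_map _ _ _ A2 al2 si2 id) => //.
- exact: euler_add_edge.
- rewrite imset_id; apply/setP => -[x y]; rewrite !in_setU1 inA [RHS]inE /dart /add_edge /=.
  by rewrite !xpair_eqE orbA orbC orbA.
- by move=> x /A2P[->|->|xA]; rewrite al2E ?eqxx // ?(negPf zz') 1?eq_sym ?(negPf zz') //;
    rewrite [z == x]eq_sym !(negPf (neA _ _ _ xA)) // alE.
- move=> x y xA yA; apply/idP/eqP => [yx|xy].
    suff: y \in [set y in A2 | y.1 == x.1] by rewrite in_set => /andP[_ /eqP->].
    apply: (stable_porbit _ _ yx); last by rewrite in_set xA eqxx.
    move=> u; rewrite in_set => /andP[uA /eqP ux]; rewrite in_set (perm_closed _ siA2) uA -ux /=.
    have tl v v' v'' : v.1 = v'.1 -> (tperm v v' v'').1 = v''.1.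
      by case: tpermP => [->|->|].
    rewrite /si2 !permM !tl ?w'1 //.
    case/A2P: uA => [->|->|uA]; [by rewrite (out_perm siA) | by rewrite (out_perm siA) |].
    by rewrite eq_sym -siE ?siP ?porbit_step.
  have [x' [x'A x'1 x'x]] := near x xA; have [y' [y'A y'1 y'y]] := near y yA.
  rewrite porbit_sym in y'y; apply: porbit_trans y'y; apply: porbit_trans x'x _.
  by apply: sub; rewrite siE // x'1 y'1 xy.
- by move=> v; have [u vu] := hv v; exists (v, u); rewrite ?AA2 ?inA.
Qed.

(** The successor and the predecessor of [p] around [h] each form a corner with [p], so
    [corner_edge] and maximality make them adjacent to [p]. Degree at least 3 keeps the two
    apart. *)
Lemma common_neighbours (T : finType) (e : rel T) h p :
  simple_graph e -> connected_graph e -> maximal_planar e -> e h p -> 2 < deg e h ->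
  exists q q', [/\ q != q', e h q, e h q', e p q & e p q'].
Proof.
move=> sim con [pl mx] ehp dh; have [es ei] := sim.
have [al [si [pm mv alE siE]]] := map_of_planar sim con pl ehp.
have siA : perm_on (darts e) si by case: pm.
have hv v : exists w, e v w.
  have [->|vh] := eqVneq v h; first by exists p.
  have [||a [b [eab /eqP <- _]]] := @exit_edge _ e (pred1 v) v h (con v h); last by exists b.
    exact: eqxx.
  by rewrite /= eq_sym.
have darth q : si (h, p) = q -> e h q.2 /\ q = (h, q.2).
  move=> hpq; have qA : q \in darts e by rewrite -hpq perm_closed // inE.
  have /eqP q1 : h == q.1.
    by rewrite -(siE (h, p) q _ qA) ?inE // -hpq porbit_step.
  move: qA; rewrite inE /dart -q1 => eq2; split=> //.
  by rewrite q1 -surjective_pairing.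
have corner r r' : e h r -> e h r' -> si (h, r) = (h, r') -> r != r' -> e r r'.
  move=> er er' rr' ne; apply/negPn/negP => nrr'.
  by apply: (mx r r') => //; apply: (corner_edge sim pm mv alE siE hv er er' rr').
have [q [eq_ hpq]] : exists q, e h q /\ si (h, p) = (h, q).
  by have [] := darth _ erefl; exists (si (h, p)).2.
have [q' [eq' hq'p]] : exists q', e h q' /\ si (h, q') = (h, p).
  pose z := si^-1 (h, p); have zp : si z = (h, p) by rewrite permKV.
  have zA : z \in darts e by rewrite -(perm_closed _ siA) zp inE.
  have /eqP z1 : z.1 == h.
    by rewrite -(siE z (h, p) zA) ?inE // -zp porbit_step.
  exists z.2; move: zA; rewrite inE /dart z1 => ->; split=> //.
  by rewrite -zp [z in _ = si z]surjective_pairing z1.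
(* At most two vertices, among them [p], that are closed under the rotation at [h] would already
   contain all of [nbhd e h]. *)
have small (B : {set T}) : h \notin B -> #|B| <= 2 -> p \in B ->
    (forall r, r \in B -> exists2 r', r' \in B & si (h, r) = (h, r')) -> False.
  move=> _ cB pB st; suff: nbhd e h \subset B by move/subset_leq_card; rewrite -/(deg e h); lia.
  apply/subsetP => r; rewrite inE => er.
  suff: (h, r) \in [set (h, r') | r' in B] by case/imsetP => r' rB [->].
  apply: (@stable_porbit _ si _ (h, p)); last by rewrite siE ?inE.
    by move=> _ /imsetP[r' r'B ->]; have [r'' ? ->] := st r' r'B; apply: imset_f.
  exact: imset_f.
exists q, q'.
have pq : p != q.
  apply/eqP => E; apply: (small [set p]); rewrite ?cards1 ?set11 //.
    by rewrite inE; apply: contraTneq ehp => ->; rewrite ei.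
  by move=> r /set1P ->; exists p; rewrite ?set11 // {2}E.
have pq' : q' != p.
  apply/eqP => E; apply: (small [set p]); rewrite ?cards1 ?set11 //.
    by rewrite inE; apply: contraTneq ehp => ->; rewrite ei.
  by move=> r /set1P ->; exists p; rewrite ?set11 // -{1}E.
split=> //; last 2 first.
- exact: corner hpq pq.
- by rewrite es; apply: corner hq'p pq'.
apply/eqP => E; apply: (small [set p; q]); rewrite ?cards2 ?pq ?set21 //.
- by rewrite !inE negb_or; apply/andP; split; [apply: contraTneq ehp|apply: contraTneq eq_] => ->; rewrite ei.
- by move=> r /set2P[]->; [exists q; rewrite ?set22|exists p; rewrite ?set21 // E].
Qed.

(** * [K5] minors and minimal counterexamples *)

Lemma card_orbits_ge3 (D : finType) (A : {set D}) (s : {perm D}) :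
  {in A, forall z, s z \in A} ->
  {in A, forall z, [/\ s z != z, s (s z) != s z & s (s z) != z]} ->
  (3 * #|porbit s @: A| <= #|A|)%N.
Proof.
move=> sA s3; have oA z w : z \in A -> w \in porbit s z -> w \in A.
  by move=> zA; apply: stable_porbit.
have part : partition (porbit s @: A) A.
  apply/and3P; split.
  - rewrite eqEsubset; apply/andP; split; apply/subsetP => z.
      by case/bigcupP=> O /imsetP[w wA ->]; apply: oA.
    by move=> zA; apply/bigcupP; exists (porbit s z); rewrite ?imset_f ?porbit_id.
  - apply/trivIsetP => O O' /imsetP[z zA ->] /imsetP[w wA ->] ne.
    rewrite -setI_eq0; apply: contraR ne => /set0Pn[t /setIP[tz tw]].
    by rewrite eq_porbit_mem; apply: porbit_trans tw _; rewrite porbit_sym.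
  - apply/negP => /imsetP[z zA /setP/(_ z)].
    by rewrite porbit_id inE.
rewrite (card_partition part) mulnC -sum_nat_const; apply: leq_sum => _ /imsetP[z zA ->].
have [n1 n2 n3] := s3 z zA.
have sub : [set z; s z; s (s z)] \subset porbit s z.
  apply/subsetP => w; rewrite !inE -orbA => /or3P[]/eqP->; rewrite ?porbit_id ?porbit_step //.
  exact: porbit_trans (porbit_step _ _) (porbit_step _ _).
apply: leq_trans (subset_leq_card sub).
by rewrite setUC cardsU1 cards2 !inE negb_or n3 n2 eq_sym n1.
Qed.

(** Euler's formula with 5 vertices and 20 darts forces 7 faces, and faces of length at least 3
    would need 21 darts. *)
Lemma K5_nonplanar (e : rel 'I_5) : simple_graph e -> (forall x y, x != y -> e x y) ->
  ~ planar e.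
Proof.
move=> [es ei] full pl; have eE x y : e x y = (x != y).
  by apply/idP/idP; [apply: contraTneq => ->; rewrite ei | apply: full].
have con : connected_graph e.
  by move=> x y; have [->|/full/connect1] := eqVneq x y.
have [al [si [[alA siA alK _ eul] mv alE siE]]] :=
  map_of_planar (conj es ei) con pl (full ord0 ord_max erefl).
move/(eulerE alK mv siA): eul.
rewrite (@vertices_card _ _ _ _ (@fst 'I_5 'I_5) siE); last first.
  move=> v; have [->|v0] := eqVneq v ord0; first by exists (ord0, ord_max); rewrite // inE; apply: full.
  by exists (v, ord0); rewrite // inE; apply: full.
have siP z : z \in darts e -> si z \in darts e by rewrite perm_closed.
have alP z : z \in darts e -> al z \in darts e by rewrite perm_closed.
have c20 : #|darts e| = 20%N.
  have -> : darts e = ~: [set (i, i) | i : 'I_5].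
    apply/setP => -[x y]; rewrite !inE /dart /= eE; congr (~~ _).
    by apply/eqP/imsetP => [->|[i _ [-> ->]] //]; exists y.
  rewrite cardsCs setCK card_imset; last by move=> i j [].
  by rewrite card_prod !card_ord.
have contra F : (2 * 5 + 2 * F = 4 + 20)%N -> (3 * F <= 20)%N -> False by lia.
rewrite card_ord c20 => /contra; apply; rewrite -c20.
have tl z : z \in darts e -> (si z).1 = z.1.
  by move=> zA; apply/esym/eqP; rewrite -siE ?siP ?porbit_step.
have phi1 z : z \in darts e -> ((al * si) z).1 = z.2.
  by move=> zA; rewrite permM tl ?alP // alE.
have phiP z : z \in darts e -> (al * si) z \in darts e by move=> zA; rewrite permM siP ?alP.
have ne z : z \in darts e -> z.1 != z.2 by rewrite inE /dart eE.
have nephi z : z \in darts e -> (al * si) z != z.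
  by move=> zA; apply: contraNneq (ne z zA) => zz; rewrite -(phi1 z zA) zz.
apply: card_orbits_ge3 => // z zA; split; rewrite ?nephi ?phiP //.
(* A face of length 2 would make [al z] a fixed point of [si], hence its tail a vertex of degree
   1. *)
apply/eqP => zz; have y1 := phi1 z zA; have w1 := phi1 _ (phiP z zA).
rewrite zz in w1; have fixed : si (al z) = al z.
  by rewrite -permM [LHS]surjective_pairing y1 -w1 alE.
have [r rz] : exists r, (r != z.1) && (r != z.2).
  have : ~: [set z.1; z.2] != set0.
    by rewrite -card_gt0 cardsCs setCK cards2 card_ord ne.
  by case/set0Pn=> r; rewrite !inE negb_or; exists r.
case/andP: rz => r1 r2; have rA : (z.2, r) \in darts e by rewrite inE /dart eE eq_sym.
have : (z.2, r) \in porbit si (al z) by rewrite siE ?alP // alE.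
move/(stable_porbit (P := [set al z])) => /(_ _ (set11 _)); rewrite inE alE // xpair_eqE.
by rewrite (negPf r1) andbF => H; suff: false by []; apply: H => _ /set1P ->; rewrite -alE // fixed set11.
Qed.

Lemma fibre_sym (T T' : finType) (e : rel T) (psi : T -> T') :
  symmetric e -> connect_sym (fibre_rel e psi).
Proof.
by move=> es; apply: sym_connect_sym => x y; rewrite /fibre_rel /= es eq_sym.
Qed.

Lemma connected_fibres_repr (T : finType) (e : rel T) (psi : T -> T) :
  symmetric e -> (forall z, connect (fibre_rel e psi) z (psi z)) -> connected_fibres e psi.
Proof.
move=> es con x y xy; apply: connect_trans (con x) _.
by rewrite xy fibre_sym.
Qed.

(** Vertices are absorbed along edges leaving [U], which partitions the graph into connected pieces
    with one vertex of [U] each. This turns minors into quotients and replaces vertex deletions by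
    contractions. *)
Lemma retraction (T : finType) (e : rel T) (U : {set T}) :
  symmetric e -> connected_graph e -> U != set0 -> exists r : T -> T,
  [/\ forall z, r z \in U, {in U, forall z, r z = z} &
      forall z, connect (fibre_rel e r) z (r z)].
Proof.
move=> es con; have [n] := ubnP #|~: U|; elim: n => // n IH in U *; rewrite ltnS => le_n U0.
have [UT|/subsetPn[y _ yU]] := boolP ([set: T] \subset U).
  by exists id; split=> // z; apply: (subsetP UT); rewrite inE.
have [x xU] := set0Pn _ U0.
have [u [v [euv uU vU]]] := exit_edge (P := [in U]) (con x y) xU yU.
have lt_n : #|~: (v |: U)| < n.
  apply: leq_trans le_n; apply: proper_card; rewrite properC; apply/properP; split.
    exact: subsetUr.
  by exists v; rewrite ?setU11.
have [|r [rU rid rcon]] := IH (v |: U) lt_n; first by apply/set0Pn; exists v; rewrite setU11.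
exists (fun z => if r z == v then u else r z); split=> [z|z zU|z].
- by case: eqP => // /eqP rv; have := rU z; rewrite in_setU1 (negPf rv).
- by rewrite rid ?setU1r //; case: eqP => // zv; rewrite -zv zU in vU.
have sub : subrel (fibre_rel e r) (fibre_rel e (fun z => if r z == v then u else r z)).
  by move=> a b /andP[eab /eqP rab]; rewrite /fibre_rel /= eab rab eqxx.
have sub' := connect_sub (fun a b ab => connect1 (sub a b ab)).
case: eqP => [rv|_]; last exact: sub' (rcon z).
apply: connect_trans (sub' _ _ (rcon z)) _; rewrite rv; apply: connect1.
rewrite /fibre_rel /= es euv rid ?setU11 // eqxx /= rid ?setU1r //.
by rewrite if_same.
Qed.

(** The branch sets need not cover the graph. Retracting onto their union distributes the remaining
    vertices and exhibits K5 as a quotient with connected fibres. *)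
Lemma no_K5_minor (T : finType) (e : rel T) (C : 'I_5 -> {set T}) :
  simple_graph e -> connected_graph e -> planar e ->
  (forall i j x, x \in C i -> x \in C j -> i = j) ->
  (forall i, {in C i &, forall x y,
     connect [rel u v | [&& e u v, u \in C i & v \in C i]] x y}) ->
  (forall i j : 'I_5, i != j -> exists x y, [/\ x \in C i, y \in C j & e x y]) -> False.
Proof.
move=> sim con pl dis cc adj; have [es ei] := sim.
have [|r [rU rid rcon]] := @retraction T e (\bigcup_i C i) es con.
  have [x [y [xC _ _]]] := adj ord0 ord_max erefl.
  by apply/set0Pn; exists x; apply/bigcupP; exists ord0.
(* The default is harmless: [g] is only applied after [r], whose values lie in branch sets. *)
pose g x := odflt ord0 [pick i | x \in C i].
have gE i x : x \in C i -> g x = i.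
  rewrite /g; case: pickP => [j xj xi|/(_ i)->] //; exact: dis xj xi.
have gC x : r x \in C (g (r x)).
  by have /bigcupP[i _ xi] := rU x; rewrite (gE i).
have inU i x : x \in C i -> r x = x by move=> xi; apply: rid; apply/bigcupP; exists i.
pose psi := g \o r.
have fib : connected_fibres e psi.
  have sub : subrel (fibre_rel e r) (fibre_rel e psi).
    by move=> a b /andP[eab /eqP rab]; rewrite /fibre_rel /psi /= eab rab eqxx.
  have sub' := connect_sub (fun a b ab => connect1 (sub a b ab)).
  have rc z : connect (fibre_rel e psi) z (r z) by apply: sub'; apply: rcon.
  move=> x y xy; apply: connect_trans (rc x) _; rewrite fibre_sym //.
  apply: connect_trans (rc y) _; rewrite fibre_sym //.
  have yC : r y \in C (g (r x)) by rewrite (_ : g (r x) = g (r y)).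
  apply: connect_sub (cc _ _ _ (gC x) yC) => a b /and3P[eab aC bC]; apply: connect1.
  by rewrite /fibre_rel /= eab /psi /= (inU _ _ aC) (inU _ _ bC) (gE _ _ aC) (gE _ _ bC) eqxx.
apply: (@K5_nonplanar (quotient_graph e psi)); first exact: quotient_simple.
  move=> i j ij; apply/quotient_graphP; split=> //.
  have [x [y [xi yj exy]]] := adj i j ij; exists x, y.
  by rewrite /psi /= (inU _ _ xi) (inU _ _ yj) (gE _ _ xi) (gE _ _ yj).
apply: planar_quotient => // i.
have [j ij] : exists j : 'I_5, i != j.
  by have [->|] := eqVneq i ord0; [exists ord_max|exists ord0].
have [x [y [xi _ _]]] := adj i j ij; exists x.
by rewrite /psi /= (inU _ _ xi) (gE _ _ xi).
Qed.

(** If the quotient on the image of [psi] were not colourable, minimality would give it at least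
    [#|T|] vertices, and [psi] would be injective. *)
Lemma colour_contraction (T : finType) (e : rel T) (psi : T -> T) :
  in_eMPGN4 e -> connected_fibres e psi -> ~ injective psi ->
  exists f : T -> 'I_4, (forall x y, psi x = psi y -> f x = f y) /\
    forall x y, e x y -> psi x != psi y -> f x != f y.
Proof.
move=> [[[es ei] con pl _] _ min] fib ninj.
pose T' := {x : T | x \in [set psi y | y : T]}.
pose phi x : T' := Sub (psi x) (imset_f psi (erefl : x \in T)).
have phiE x y : (phi x == phi y) = (psi x == psi y) by rewrite -val_eqE.
pose e' := quotient_graph e phi.
(* Searching among finite functions makes colourability of the quotient decidable. *)
have [/existsP[c /forallP cP]|nc] :=
    boolP [exists c : {ffun T' -> 'I_4}, forall x, forall y, e' x y ==> (c x != c y)].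
  exists (fun x => c (phi x)); split=> [x y /eqP xy|x y exy xy].
    by congr (c _); apply/eqP; rewrite phiE.
  move: (cP (phi x)) => /forallP/(_ (phi y))/implyP; apply.
  by apply/quotient_graphP; rewrite phiE; split=> //; exists x, y.
have sur u : exists x, phi x = u.
  case: u => u up; have /imsetP[x _ xu] := up; exists x; apply: val_inj.
  by rewrite /= xu.
have fib' : connected_fibres e phi.
  move=> x y /eqP; rewrite phiE => /eqP xy; apply: connect_sub (fib x y xy) => a b /andP[eab ab].
  by apply: connect1; rewrite /fibre_rel /= eab phiE.
suff : #|T| <= #|{: T'}|.
  rewrite card_sig => le.
  have /imset_injP inj : #|[set psi y | y : T]| == #|T|.
    rewrite eqn_leq leq_imset_card; apply: leq_trans le _.
    by apply: subset_leq_card; apply/subsetP => x; rewrite inE.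
  by case: ninj => a b ab; apply: inj.
apply: (min _ e'); split.
- exact: quotient_simple.
- exact: quotient_connected.
- exact: planar_quotient.
- case=> c cP; case/negP: nc; apply/existsP; exists [ffun x => c x].
  by apply/forallP => x; apply/forallP => y; apply/implyP => /cP; rewrite !ffunE.
Qed.

(** Deleting the vertices outside [S] might disconnect the graph and take it out of reach of
    minimality. Contracting them into [S] keeps it connected and keeps the edges within [S]. *)
Lemma colour_subset (T : finType) (e : rel T) (S : {set T}) z :
  in_eMPGN4 e -> z \notin S ->
  exists f : T -> 'I_4, {in S &, forall x y, e x y -> f x != f y}.
Proof.
move=> min zS; have [[[es ei] con _ _] _ _] := min.
have [->|S0] := eqVneq S set0; first by exists (fun=> ord0) => x y; rewrite inE.
have [r [rS rid rcon]] := retraction es con S0.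
have [|f [_ fP]] := colour_contraction min (connected_fibres_repr es rcon).
  by move=> rI; have := rS z; rewrite (rI _ _ (rid _ (rS z))) (negPf zS).
exists f => x y xS yS exy; apply: fP => //; rewrite !rid //.
by apply: contraTneq exy => ->; rewrite ei.
Qed.

Lemma perm_triple (C : finType) (a b c a' b' c' : C) :
  uniq [:: a; b; c] -> uniq [:: a'; b'; c'] ->
  exists s : {perm C}, [/\ s a = a', s b = b' & s c = c'].
Proof.
rewrite /= !inE !negb_or !andbT => /andP[/andP[ab ac] bc] /andP[/andP[ab' ac'] bc'].
pose s1 := tperm a a'; pose s2 := s1 * tperm (s1 b) b'; pose s3 := s2 * tperm (s2 c) c'.
have s1a : s1 a = a' by rewrite tpermL.
have s2b : s2 b = b' by rewrite permM tpermL.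
have s2a : s2 a = a'.
  by rewrite permM s1a tpermD // 1?eq_sym // -s1a (inj_eq perm_inj).
exists s3; split; last by rewrite permM tpermL.
  by rewrite permM s2a tpermD // 1?eq_sym // -s2a (inj_eq perm_inj).
by rewrite permM s2b tpermD // 1?eq_sym // -s2b (inj_eq perm_inj).
Qed.

Definition avoid (T : finType) (e : rel T) (X : {set T}) : rel T :=
  [rel a b | [&& e a b, a \notin X & b \notin X]].

(** Otherwise both sides of the triangle, each taken with the triangle, are colourable by
    minimality. The triangle has three distinct colours in both colourings, so a permutation of
    colours makes them agree there. *)
Lemma no_separating_triangle (T : finType) (e : rel T) x y z u w :
  in_eMPGN4 e -> e x y -> e y z -> e x z ->
  u \notin [set x; y; z] -> w \notin [set x; y; z] ->
  connect (avoid e [set x; y; z]) u w.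
Proof.
move=> min exy eyz exz; set X := [set x; y; z] => uX wX; apply/negPn/negP => nuw.
have [[[es ei] con _ nc] _ _] := min.
pose K := [set v | connect (avoid e X) u v].
have KX v : v \in K -> v \notin X.
  rewrite inE => /connectP[p pth ->]; case/lastP: p pth => [|p t] //.
  by rewrite rcons_path last_rcons => /andP[_ /and3P[]].
have uK : u \in K by rewrite inE.
have out a b : a \in K -> b \notin K -> e a b -> b \in X.
  move=> aK bK eab; apply: contraR bK => bX; move: (aK); rewrite !inE => ua.
  by apply: connect_trans ua (connect1 _); rewrite /avoid /= eab bX KX.
have wS : w \notin K :|: X by rewrite in_setU negb_or inE nuw.
have uS : u \notin ~: K by rewrite inE uK.
have [f1 f1P] := colour_subset min wS; have [f2 f2P] := colour_subset min uS.
have inX v : v \in [:: x; y; z] -> v \in X by rewrite !inE orbA.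
have S1 v : v \in X -> v \in K :|: X by move=> vX; rewrite in_setU vX orbT.
have S2 v : v \in X -> v \in ~: K by move=> vX; rewrite in_setC; apply: contraL vX; apply: KX.
have xX := inX x (mem_head _ _); have yX : y \in X by rewrite !inE eqxx orbT.
have zX : z \in X by rewrite !inE eqxx orbT.
have [||s [sx sy sz]] := @perm_triple _ (f1 x) (f1 y) (f1 z) (f2 x) (f2 y) (f2 z).
- by rewrite /= !inE negb_or !f1P ?S1.
- by rewrite /= !inE negb_or !f2P ?S2.
have sX v : v \in X -> s (f1 v) = f2 v by rewrite !inE -orbA => /or3P[]/eqP->.
apply: nc; exists (fun v => if v \in K then s (f1 v) else f2 v) => a b eab.
case: ifP => aK; case: ifP => bK.
- by rewrite (inj_eq perm_inj) f1P // in_setU ?aK ?bK.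
- have bX := out a b aK (negbT bK) eab.
  by rewrite -sX // (inj_eq perm_inj) f1P ?(S1 b) // in_setU aK.
- have aX : a \in X by apply: (out b) => //; rewrite ?aK // es.
  by rewrite -sX // (inj_eq perm_inj) f1P ?(S1 a) // in_setU bK.
- by rewrite f2P // in_setC ?aK ?bK.
Qed.

Local Close Scope group_scope.

(** * Crossing chords *)

Definition inside (T : finType) (e : rel T) (C : {set T}) : rel T :=
  [rel u v | [&& e u v, u \in C & v \in C]].

Lemma path_inside (T : finType) (e : rel T) (C : {set T}) x s y :
  path e x s -> {subset x :: s <= C} -> y \in x :: s -> connect (inside e C) x y.
Proof.
elim: s x => [|z s IH] x /=; first by move=> _ _; rewrite inE => /eqP->.
case/andP=> xz pth sub; rewrite inE => /predU1P[->//|ys].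
apply: connect_trans (connect1 _) (IH z pth _ ys); last first.
  by move=> t ts; apply: sub; rewrite inE ts orbT.
by rewrite /inside /= xz !sub // !inE ?eqxx ?orbT.
Qed.

Section Crossing.
Variables (T : finType) (e : rel T) (H : {set T}).
Hypotheses (sim : simple_graph e) (con : connected_graph e) (pl : planar e).
Hypothesis Hcon : {in H &, forall x y, connect (inside e H) x y}.

Definition on_hub v := (v \notin H) && [exists h in H, e h v].

Lemma inside_sym C : connect_sym (inside e C).
Proof.
have [es _] := sim; apply: sym_connect_sym => x y.
by rewrite /inside /= es [X in _ && X]andbC.
Qed.

(* [H] and the four seqs below are the branch sets of a [K5] minor. *)
Lemma no_hub_K4 a1 s1 p b1 s2 q a2 s3 b2 s4 :
  uniq ((a1 :: s1 ++ p) ++ (b1 :: s2 ++ q) ++ (a2 :: s3) ++ (b2 :: s4)) ->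
  all [predC H] ((a1 :: s1 ++ p) ++ (b1 :: s2 ++ q) ++ (a2 :: s3) ++ (b2 :: s4)) ->
  all on_hub [:: a1; b1; a2; b2] ->
  path e a1 s1 -> path e a1 p -> path e b1 s2 -> path e b1 q ->
  path e a2 s3 -> path e b2 s4 ->
  e (last a1 s1) b1 -> e (last b1 s2) a2 -> e (last a2 s3) b2 -> e (last b2 s4) a1 ->
  e (last a1 p) a2 -> e (last b1 q) b2 -> False.
Proof.
set l1 := _ :: s1 ++ p; set l2 := b1 :: _; set l3 := a2 :: _; set l4 := b2 :: _.
move=> un offH hub ps1 pp ps2 pq ps3 ps4 e12 e23 e34 e41 e13 e24; have [es ei] := sim.
pose L : seq {set T} := [:: H; [set x in l1]; [set x in l2]; [set x in l3]; [set x in l4]].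
pose C (i : 'I_5) := nth set0 L i.
move: un offH; rewrite !cat_uniq !all_cat => /and3P[_ d1 /and3P[_ d2 /and3P[_ d3 _]]].
case/and4P=> /allP h1 /allP h2 /allP h3 /allP h4.
have lt_dis (i j : 'I_5) x : i < j -> x \in C i -> x \in C j -> False.
  have d x' (l l' : seq T) : ~~ has (mem l) l' -> x' \in l -> x' \in l' -> False.
    by move=> /hasPn dl xl /dl; rewrite /= xl.
  case: i j => [[|[|[|[|[|//]]]]] ?] [[|[|[|[|[|//]]]]] ?] //= _;
    rewrite /C /= ?in_set => xi xj.
  - by have := h1 x xj; rewrite /= xi.
  - by have := h2 x xj; rewrite /= xi.
  - by have := h3 x xj; rewrite /= xi.
  - by have := h4 x xj; rewrite /= xi.
  - by apply: (d x _ _ d1 xi); rewrite !mem_cat xj.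
  - by apply: (d x _ _ d1 xi); rewrite !mem_cat xj !orbT.
  - by apply: (d x _ _ d1 xi); rewrite !mem_cat xj !orbT.
  - by apply: (d x _ _ d2 xi); rewrite !mem_cat xj.
  - by apply: (d x _ _ d2 xi); rewrite !mem_cat xj !orbT.
  - exact: (d x _ _ d3 xi).
have star z (K : {set T}) : {in K, forall y, connect (inside e K) z y} ->
    {in K &, forall x y, connect (inside e K) x y}.
  by move=> zK x y xK yK; apply: connect_trans (zK y yK); rewrite inside_sym zK.
have two a s t : path e a s -> path e a t ->
    {in [set x in a :: s ++ t] &, forall x y, connect (inside e [set x in a :: s ++ t]) x y}.
  move=> pas pat; apply: (star a) => y; rewrite in_set -cat_cons mem_cat => /orP[ys|yt].
    by apply: (path_inside pas) => // z zs; rewrite in_set mem_cat zs.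
  apply: (path_inside pat); last by rewrite inE yt orbT.
  move=> z; rewrite in_set mem_cat !inE => /orP[->//|->]; by rewrite !orbT.
have lastm x s t : last x s \in x :: s ++ t.
  by rewrite -cat_cons mem_cat mem_last.
have lastm' x s t : last x t \in x :: s ++ t.
  by have := mem_last x t; rewrite !inE mem_cat => /orP[->|->]; rewrite ?orbT.
apply: (@no_K5_minor _ e C) => //.
- move=> i j x xi xj; case: (ltngtP i j) => [lt_ij|lt_ji|/val_inj//].
    by case: (lt_dis i j x).
  by case: (lt_dis j i x).
- case=> [[|[|[|[|[|//]]]]] ?]; rewrite /C /=; first exact: Hcon.
  + exact: two.
  + exact: two.
  + by have := two a2 s3 [::] ps3 isT; rewrite cats0.
  + by have := two b2 s4 [::] ps4 isT; rewrite cats0.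
have lt_adj (i j : 'I_5) : i < j -> exists x y, [/\ x \in C i, y \in C j & e x y].
  move: hub; rewrite /= !andbT.
  case/and4P=> /andP[_ /exists_inP[g1 ? ?]] /andP[_ /exists_inP[g2 ? ?]]
               /andP[_ /exists_inP[g3 ? ?]] /andP[_ /exists_inP[g4 ? ?]].
  case: i j => [[|[|[|[|[|//]]]]] ?] [[|[|[|[|[|//]]]]] ?] //= _; rewrite /C /=.
  - by exists g1, a1; rewrite !inE eqxx.
  - by exists g2, b1; rewrite !inE eqxx.
  - by exists g3, a2; rewrite !inE eqxx.
  - by exists g4, b2; rewrite !inE eqxx.
  - by exists (last a1 s1), b1; rewrite in_set lastm inE mem_head.
  - by exists (last a1 p), a2; rewrite in_set lastm' inE mem_head.
  - by exists a1, (last b2 s4); rewrite in_set mem_head inE mem_last es.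
  - by exists (last b1 s2), a2; rewrite in_set lastm inE mem_head.
  - by exists (last b1 q), b2; rewrite in_set lastm' inE mem_head.
  - by exists (last a2 s3), b2; rewrite in_set mem_last inE mem_head.
move=> i j ij; case: (ltngtP i j) => [|lt_ji|/val_inj E]; first exact: lt_adj.
  by have [x [y [xj yi exy]]] := lt_adj _ _ lt_ji; exists y, x; rewrite es.
by rewrite E eqxx in ij.
Qed.

Definition ring_around r := [/\ path.cycle e r, uniq r & all on_hub r].

Definition link a p b := [/\ path e a p, last a p = b, uniq (a :: p) & all [predC H] (a :: p)].

Definition crossing a1 s1 b1 s2 a2 s3 b2 s4 p q :=
  [/\ ring_around (a1 :: s1 ++ b1 :: s2 ++ a2 :: s3 ++ b2 :: s4),
      link a1 p a2, link b1 q b2 & {in a1 :: p, forall v, v \notin b1 :: q}].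

Lemma ring_around_catC r r' : ring_around (r ++ r') -> ring_around (r' ++ r).
Proof.
case=> cyc un hub; split; last by rewrite all_cat andbC -all_cat.
  by rewrite -(rot_cycle (size r)) rot_size_cat in cyc.
by rewrite uniq_catC.
Qed.

Lemma link_rev a p b : link a p b -> exists p', [/\ link b p' a, size p' = size p &
  b :: p' =i a :: p].
Proof.
case=> pth lst un offH; have [es _] := sim.
have E : b :: rev (belast a p) = rev (a :: p).
  by rewrite [in RHS]lastI rev_rcons lst.
exists (rev (belast a p)); split; last by rewrite E => v; rewrite mem_rev.
  split; last by rewrite E all_rev.
  - by rewrite -lst rev_path (eq_path (e' := e)) // => x y; rewrite es.
  - by have := congr1 (last b) E; rewrite rev_cons last_rcons.
  - by rewrite E rev_uniq.
by rewrite size_rev size_belast.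
Qed.

Lemma link_prefix a p z r b : link a (p ++ z :: r) b -> link a (rcons p z) z.
Proof.
rewrite -cat_rcons => -[pth _ un offH]; split.
- by move: pth; rewrite cat_path => /andP[].
- by rewrite last_rcons.
- by move: un; rewrite -cat_cons cat_uniq => /andP[].
- by move: offH; rewrite -cat_cons all_cat => /andP[].
Qed.

Lemma link_suffix a p z r b : link a (p ++ z :: r) b -> link z r b.
Proof.
case=> pth lst un offH; split.
- by move: pth; rewrite cat_path => /and3P[].
- by move: lst; rewrite last_cat.
- by move: un; rewrite -cat_cons cat_uniq => /and3P[].
- by move: offH; rewrite -cat_cons all_cat => /andP[].
Qed.

(** This stands in for the Jordan curve theorem outside [H]. Two chords that meet the ring only at
    their ends are cut into the branch sets of [no_hub_K4]; the others are shortened by induction on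
    their total length. *)
Lemma no_crossing a1 s1 b1 s2 a2 s3 b2 s4 p q :
  ring_around (a1 :: s1 ++ b1 :: s2 ++ a2 :: s3 ++ b2 :: s4) ->
  link a1 p a2 -> link b1 q b2 -> {in a1 :: p, forall v, v \notin b1 :: q} -> False.
Proof.
move=> ro lp lq dis; have : crossing a1 s1 b1 s2 a2 s3 b2 s4 p q by [].
have [n] := ubnP (size p + size q); elim: n => // n IH in a1 s1 b1 s2 a2 s3 b2 s4 p q ro lp lq dis *.
(* A chord through a further ring vertex can be replaced by a shorter one. *)
have shrink a1' s1' b1' s2' a2' s3' b2' s4' p' z p'' q' :
    size (p' ++ z :: p'') + size q' < n.+1 ->
    crossing a1' s1' b1' s2' a2' s3' b2' s4' (p' ++ z :: p'') q' -> p'' != [::] ->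
    z \in a1' :: s1' ++ b1' :: s2' ++ a2' :: s3' ++ b2' :: s4' -> False.
  move=> le_n [ro' lp' lq' dis'] p''0.
  have zP : z \in a1' :: p' ++ z :: p'' by rewrite inE mem_cat mem_head !orbT.
  have sufx : {in z :: p'', forall v, v \notin b1' :: q'}.
    by move=> v vp; apply: dis'; rewrite -cat_cons mem_cat vp orbT.
  have prex : {in a1' :: rcons p' z, forall v, v \notin b1' :: q'}.
    by move=> v vp; apply: dis'; rewrite -cat_rcons -cat_cons mem_cat vp.
  have lt_suf : size p'' + size q' < n by move: le_n; rewrite size_cat /=; lia.
  have lt_pre : size (rcons p' z) + size q' < n.
    move: le_n p''0; rewrite size_cat size_rcons; case: (p'') => //= *; lia.
  have lsuf := link_suffix lp'; have lpre := link_prefix lp'.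
  have [_ lst un _] := lp'; have [_ lstq _ _] := lq'.
  (* If [z] lies on the arc [s1'] or [s4'], the part of the chord after [z] still crosses the other
     chord; on [s2'] or [s3'], the part before [z] does. *)
  rewrite inE => /predU1P[za|]; first by move: un; rewrite -za /= mem_cat mem_head orbT.
  rewrite mem_cat => /orP[zs|].
    case/splitPr: zs ro' => t t' ro'.
    have ro2 : ring_around (z :: t' ++ b1' :: s2' ++ a2' :: s3' ++ b2' :: (s4' ++ a1' :: t)).
      have := @ring_around_catC (a1' :: t) (z :: t' ++ b1' :: s2' ++ a2' :: s3' ++ b2' :: s4').
      by move: ro'; rewrite !(cat_cons, =^~ catA) => ro' /(_ ro').
    exact: (IH _ _ _ _ _ _ _ _ _ _ ro2 lsuf lq' sufx).
  rewrite inE => /predU1P[zb|]; first by have := dis' z zP; rewrite zb mem_head.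
  rewrite mem_cat => /orP[zs|].
    case/splitPr: zs ro' => t t' ro'.
    have ro2 : ring_around (a1' :: s1' ++ b1' :: t ++ z :: (t' ++ a2' :: s3') ++ b2' :: s4').
      by move: ro'; rewrite !(cat_cons, =^~ catA).
    exact: (IH _ _ _ _ _ _ _ _ _ _ ro2 lpre lq' prex).
  rewrite inE => /predU1P[za|].
    move: un; rewrite -cat_cons cat_uniq => /and3P[_ _ /andP[/negP[]]].
    rewrite za -lst last_cat /=; case: (p'') p''0 => //= x s _; exact: mem_last.
  rewrite mem_cat => /orP[zs|].
    case/splitPr: zs ro' => t t' ro'.
    have ro2 : ring_around (a1' :: s1' ++ b1' :: (s2' ++ a2' :: t) ++ z :: t' ++ b2' :: s4').
      by move: ro'; rewrite !(cat_cons, =^~ catA).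
    exact: (IH _ _ _ _ _ _ _ _ _ _ ro2 lpre lq' prex).
  rewrite inE => /predU1P[zb|].
    by have := dis' z zP; rewrite zb -lstq mem_last.
  move=> zs; case/splitPr: zs ro' => t t' ro'.
  have ro2 : ring_around (z :: (t' ++ a1' :: s1') ++ b1' :: s2' ++ a2' :: s3' ++ b2' :: t).
    have := @ring_around_catC (a1' :: s1' ++ b1' :: s2' ++ a2' :: s3' ++ b2' :: t) (z :: t').
    by move: ro'; rewrite !(cat_cons, =^~ catA) => ro' /(_ ro').
  exact: (IH _ _ _ _ _ _ _ _ _ _ ro2 lsuf lq' sufx).
move=> le_n _; set R := a1 :: _ in ro.
have lastp a r b : a != b -> link a r b -> exists r', r = rcons r' b.
  move=> ab [_ + _ _]; case/lastP: r => [/= ba|r' x]; first by rewrite ba eqxx in ab.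
  by rewrite last_rcons => ->; exists r'.
have [_ unR hubR] := ro.
have a12 : a1 != a2.
  apply: contraTneq unR => E; rewrite /R E /= negb_and; apply/orP; left.
  by rewrite !(mem_cat, inE) eqxx !orbT.
have b12 : b1 != b2.
  apply: contraTneq unR => E; rewrite /R E /= cat_uniq /= !(mem_cat, inE) eqxx !orbT /=.
  by rewrite !andbF.
have [p' pE] := lastp _ _ _ a12 lp; have [q' qE] := lastp _ _ _ b12 lq.
have [/hasP[z zp zR]|/hasPn offp] := boolP (has [in R] p').
  case/splitPr: zp pE => t t' pE; rewrite {}pE rcons_cat /= in lp dis le_n.
  by apply: (shrink _ _ _ _ _ _ _ _ _ _ _ _ le_n) zR => //; case: (t').
have [/hasP[z zq zR]|/hasPn offq] := boolP (has [in R] q').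
  (* Reading the ring from [b1] makes [q] the first chord and the reverse of [p] the second, so
     [shrink] applies again. *)
  have [pr [lpr szpr memp]] := link_rev lp.
  case/splitPr: zq qE => t t' qE; rewrite {}qE rcons_cat /= in lq dis le_n.
  apply: (@shrink b1 s2 a2 s3 b2 s4 a1 s1 t z (rcons t' b2) pr).
  - by rewrite szpr addnC.
  - split=> //.
      have := @ring_around_catC (a1 :: s1) (b1 :: s2 ++ a2 :: s3 ++ b2 :: s4).
      by move: ro; rewrite /R !(cat_cons, =^~ catA) => ro /(_ ro).
    by move=> v vq; rewrite memp; apply: contraL vq; apply: dis.
  - by case: (t').
  - have : z \in (a1 :: s1) ++ (b1 :: s2 ++ a2 :: s3 ++ b2 :: s4) by [].
    by rewrite mem_cat orbC -mem_cat !(cat_cons, =^~ catA).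
have [cycR _ _] := ro; have [pp _ unp Hp] := lp; have [pq _ unq Hq] := lq.
move: cycR pp pq; rewrite /R pE qE /= rcons_cat cat_path /= rcons_cat cat_path /= rcons_cat.
rewrite cat_path /= !rcons_path.
case/and3P=> c1 e12 /and3P[c2 e23 /and3P[c3 e34 /andP[c4 e41]]] /andP[pp e13] /andP[pq e24].
have perm_R : perm_eq (R ++ (p' ++ q'))
    ((a1 :: s1 ++ p') ++ (b1 :: s2 ++ q') ++ (a2 :: s3) ++ (b2 :: s4)).
  apply/seq.permP => P; rewrite /R; do 4!rewrite ?count_cat /=.
  move: (nat_of_bool (P a1)) (nat_of_bool (P a2)) (nat_of_bool (P b1)) (nat_of_bool (P b2)).
  by move: (count P s1) (count P s2) (count P s3) (count P s4) (count P p') (count P q'); clear; lia.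
have sub_p : {subset p' <= a1 :: p} by move=> v vp; rewrite pE inE mem_rcons inE vp !orbT.
have sub_q : {subset q' <= b1 :: q} by move=> v vq; rewrite qE inE mem_rcons inE vq !orbT.
apply: (@no_hub_K4 a1 s1 p' b1 s2 q' a2 s3 b2 s4) => //.
- rewrite -(perm_uniq perm_R) cat_uniq unR cat_uniq /=.
  move: unp unq; rewrite pE qE /= !rcons_uniq => /and3P[_ _ ->] /and3P[_ _ ->].
  rewrite andbT /=; apply/andP; split.
    by apply/hasPn => v; rewrite mem_cat => /orP[/offp|/offq].
  by apply/hasPn => v /sub_q vq; apply: contraL vq => /sub_p; apply: dis.
- rewrite -(perm_all _ perm_R) !all_cat; apply/and3P; split.
  + by apply: sub_all hubR => v /andP[].
  + by apply/allP => v /sub_p; apply: (allP Hp).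
  + by apply/allP => v /sub_q; apply: (allP Hq).
- have hR v : v \in R -> on_hub v by apply: (allP hubR).
  by rewrite /= !hR // !(mem_cat, inE) eqxx ?orbT.
Qed.
End Crossing.

Lemma uniq_path (T : finType) (e r : rel T) (P : pred T) a b :
  connect r a b -> P a -> (forall u v, r u v -> e u v /\ P v) ->
  exists p, [/\ path e a p, last a p = b, uniq (a :: p) & all P (a :: p)].
Proof.
case/connectP=> p0 /shortenP[p pth un _] -> Pa rP; exists p; split=> //.
  by apply: sub_path pth => u v /rP[].
elim: p a pth Pa {un} => [|v p IH] a /=; first by move=> _ ->.
by case/andP=> /rP[_ Pv] pth ->; apply: IH.
Qed.

(** The triangle on [h], [p], [q] does not separate [r] from [s]. A path joining them off the
    triangle crosses the chord from [p] to [q] on the ring around the hub [h]. *)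
Lemma no_chord (T : finType) (e : rel T) h p r R q s S :
  in_eMPGN4 e -> path.cycle e (p :: r :: R ++ q :: s :: S) ->
  uniq (p :: r :: R ++ q :: s :: S) -> all (e h) (p :: r :: R ++ q :: s :: S) ->
  ~~ e p q.
Proof.
move=> min cyc un hub; apply/negP => epq.
have [[sim con pl _] _ _] := min; have [es ei] := sim.
have hubE v : v \in p :: r :: R ++ q :: s :: S -> e h v by apply: (allP hub).
have hne v : e h v -> v != h by apply: contraTneq => ->; rewrite ei.
have hp : e h p by rewrite hubE // !(mem_cat, inE, eqxx, orbT).
have hq : e h q by rewrite hubE // !(mem_cat, inE, eqxx, orbT).
have hr : e h r by rewrite hubE // !(mem_cat, inE, eqxx, orbT).
have hs : e h s by rewrite hubE // !(mem_cat, inE, eqxx, orbT).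
have rX : r \notin [set h; p; q].
  rewrite !inE !negb_or hne //=; apply/andP; split.
    by apply: contraTneq un => ->; rewrite /= !(mem_cat, inE, eqxx, orbT).
  by apply: contraTneq un => ->; rewrite /= !(mem_cat, inE, eqxx, orbT) /= andbF.
have sX : s \notin [set h; p; q].
  rewrite !inE !negb_or hne //=; apply/andP; split.
    by apply: contraTneq un => ->; rewrite /= !(mem_cat, inE, eqxx, orbT).
  apply: contraTneq un => ->; rewrite -!cat_cons cat_uniq /= !(mem_cat, inE, eqxx, orbT) /=.
  by rewrite !andbF.
have := no_separating_triangle min hp epq hq rX sX.
case/(@uniq_path _ e _ [predC [set h; p; q]])=> //.
  by move=> u v /and3P[].
move=> Q [pth lst unQ offQ].
have pq : p != q by apply: contraTneq epq => ->; rewrite ei.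
apply: (@no_crossing _ e [set h] sim con pl _ p [::] r R q [::] s S [:: q] Q).
- by move=> u v; rewrite !inE => /eqP-> /eqP->.
- split=> //; apply: sub_all hub => v hv.
  by rewrite /on_hub inE hne //; apply/exists_inP; exists h; rewrite ?set11.
- split; [by rewrite /= epq | by [] | by rewrite /= inE pq | by rewrite /= !inE !hne].
- split=> //; apply: sub_all offQ => v; rewrite /= !inE !negb_or.
  by case/andP=> /andP[].
- move=> v; rewrite !inE => vpq; apply: contraL (vpq) => /(allP offQ).
  by rewrite /= !inE !negb_or => /andP[/andP[_ /negPf->] /negPf->].
Qed.

(** * Kempe interchanges and computed extensions of ring colourings *)

Section Kempe.
Variables (T : finType) (e : rel T) (O : pred T).
Hypothesis es : symmetric e.
Implicit Types (f : T -> 'I_4) (al be : 'I_4).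

Definition proper_on f := forall u v, O u -> O v -> e u v -> f u != f v.

Definition kempe f al be : rel T :=
  [rel u v | [&& e u v, O u, O v, f u \in [:: al; be] & f v \in [:: al; be]]].

Definition kempe_swap f al be w : T -> 'I_4 :=
  fun v => if connect (kempe f al be) w v then tperm al be (f v) else f v.

Lemma kempe_swap_proper f al be w : proper_on f -> O w -> f w \in [:: al; be] ->
  proper_on (kempe_swap f al be w).
Proof.
move=> fP Ow fw.
have chain v : connect (kempe f al be) w v -> f v \in [:: al; be].
  case/connectP=> p pth ->; case/lastP: p pth => [|p t] //.
  by rewrite rcons_path last_rcons => /andP[_ /and5P[]].
have tP x : x \in [:: al; be] -> tperm al be x \in [:: al; be].
  by rewrite !inE => /orP[]/eqP->; rewrite ?tpermL ?tpermR eqxx ?orbT.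
have half u v : O u -> O v -> e u v -> connect (kempe f al be) w u ->
    ~~ connect (kempe f al be) w v -> tperm al be (f u) != f v.
  move=> Ou Ov uv wu; have fu := chain u wu; apply: contraNneq => E; apply: connect_trans wu (connect1 _).
  by apply/and5P; split=> //; rewrite -E tP.
move=> u v Ou Ov uv; rewrite /kempe_swap; case: ifP => wu; case: ifP => wv.
- by rewrite (inj_eq perm_inj) fP.
- by apply: half => //; rewrite wv.
- by rewrite eq_sym; apply: half => //; rewrite ?wu // es.
- exact: fP.
Qed.

Lemma kempe_swap_out f al be w v : f v \notin [:: al; be] ->
  kempe_swap f al be w v = f v.
Proof.
rewrite /kempe_swap !inE negb_or => /andP[va vb]; case: ifP => // _.
by rewrite tpermD // eq_sym.
Qed.

Lemma kempe_sym f al be : connect_sym (kempe f al be).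
Proof.
apply: sym_connect_sym => u v; rewrite /kempe /= es.
by rewrite (andbCA (O u)) (andbC (f u \in _)).
Qed.
End Kempe.

(* Written with [if] and [find] rather than [&&] and [has], which are strict
   under [vm_compute]. *)
Definition has_colour (l : seq nat) (P : nat -> bool) : bool :=
  find (fun k => if k \in l then false else P k) (iota 0 4) < 4.

(* The colours of the ring [d u1 u2 u3 x u4 u5 u6] extend to the interior. *)
Definition extendable (d u1 u2 u3 x u4 u5 u6 : nat) : bool :=
  has_colour [:: u3; x; u4] (fun c => has_colour [:: c; u2; u3] (fun v2 =>
  has_colour [:: v2; d; u1; u2] (fun v1 => has_colour [:: c; d; v1; v2] (fun a =>
  has_colour [:: c; u4; u5] (fun v4 => has_colour [:: v4; d; u5; u6] (fun v5 =>
  has_colour [:: a; c; d; v4; v5] xpredT)))))).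

Definition all4 (P : nat -> bool) := all P (iota 0 4).

Lemma all4P P (k : 'I_4) : all4 P -> P k.
Proof. by move/allP; apply; rewrite mem_iota ltn_ord. Qed.

(** Besides ring adjacency, the exclusions record what the contraction forces: [u3] differs from [d]
    and [u1], [u4] from [d], and [u6] from [u4]. There is no seventh neighbour, so [u3] also fills
    the place of [x]. *)
Lemma extendable_deg6 :
  all4 (fun d => all4 (fun u1 => if d == u1 then true else
  all4 (fun u2 => if u1 == u2 then true else
  all4 (fun u3 => if u3 \in [:: u2; d; u1] then true else
  all4 (fun u4 => if u4 \in [:: u3; d] then true else
  all4 (fun u5 => if u4 == u5 then true else
  all4 (fun u6 => if u6 \in [:: u5; d; u4] then true else
  extendable d u1 u2 u3 u3 u4 u5 u6))))))).
Proof. by vm_compute. Qed.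

(** The contraction gives [u5] the colour of [d], and forces [u3] to differ from [d] and [u1], and
    [x] and [u4] from [d]. The second disjunct is the exceptional colouring. *)
Lemma extendable_deg7 :
  all4 (fun d => all4 (fun u1 => if d == u1 then true else
  all4 (fun u2 => if u1 == u2 then true else
  all4 (fun u3 => if u3 \in [:: u2; d; u1] then true else
  all4 (fun x => if x \in [:: u3; d] then true else
  all4 (fun u4 => if u4 \in [:: x; d] then true else
  all4 (fun u6 => if u6 == d then true else
  extendable d u1 u2 u3 x u4 d u6 ||
    [&& uniq [:: d; u1; u2; u3], x == u1, u4 == u2 & u6 == u2]))))))).
Proof. by vm_compute. Qed.

(* The ring colourings reached by Kempe interchanges in [not_deg7]. *)
Lemma extendable_kempe :
  all4 (fun a => all4 (fun b => all4 (fun c => all4 (fun d =>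
  if uniq [:: a; b; c; d] then
    [&& extendable a b c d b c a b, extendable a b c d c b a c,
        extendable a b d c b c d c & extendable a b c d a c d c] else true)))).
Proof. by vm_compute. Qed.

(** * The dumbbell *)

(** Chains over complementary pairs of colours share no vertex, so they would be crossing chords.
    The rotation [rot k] lets the ring be read from any of its vertices. *)
Lemma kempe_no_crossing (T : finType) (e : rel T) (H : {set T}) (r : seq T) k
    (f : T -> 'I_4) al be ga de a1 s1 b1 s2 a2 s3 b2 s4 :
  simple_graph e -> connected_graph e -> planar e ->
  {in H &, forall x y, connect (inside e H) x y} -> ring_around e H r ->
  rot k r = a1 :: s1 ++ b1 :: s2 ++ a2 :: s3 ++ b2 :: s4 ->
  uniq [:: al; be; ga; de] -> f a1 \in [:: al; be] -> f b1 \in [:: ga; de] ->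
  connect (kempe e [predC H] f al be) a1 a2 -> ~~ connect (kempe e [predC H] f ga de) b1 b2.
Proof.
move=> sim con pl Hcon ro rotE un fa fb ca; apply/negP => cb.
have ro' : ring_around e H (a1 :: s1 ++ b1 :: s2 ++ a2 :: s3 ++ b2 :: s4).
  by rewrite -rotE; apply: ring_around_catC; rewrite cat_take_drop.
have offH v : v \in a1 :: s1 ++ b1 :: s2 ++ a2 :: s3 ++ b2 :: s4 -> v \notin H.
  by have [_ _ /allP hub] := ro'; move/hub => /andP[].
have [|u v|p [pp lp up Pp]] := @uniq_path _ e _
    [pred v | (v \notin H) && (f v \in [:: al; be])] _ _ ca.
- by rewrite /= fa offH // mem_head.
- by case/and5P=> uv _ vO _ vf; split=> //; apply/andP.
have [|u v|q [pq lq uq Pq]] := @uniq_path _ e _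
    [pred v | (v \notin H) && (f v \in [:: ga; de])] _ _ cb.
- by rewrite /= fb offH // -cat_cons mem_cat mem_head orbT.
- by case/and5P=> uv _ vO _ vf; split=> //; apply/andP.
apply: (no_crossing sim con pl Hcon ro' (p := p) (q := q)).
- by split=> //; apply: sub_all Pp => v /andP[].
- by split=> //; apply: sub_all Pq => v /andP[].
- move=> v /(allP Pp)/andP[_ vp]; apply/negP => /(allP Pq)/andP[_ vq].
  move: un vp vq; rewrite /= !inE !negb_or => /and4P[/and3P[_ ag ad] /andP[bg bd] _ _].
  by case/orP=> /eqP->; rewrite ?(negPf ag) ?(negPf ad) ?(negPf bg) ?(negPf bd).
Qed.

Lemma has_colourP l P : has_colour l P -> exists k : 'I_4, (k : nat) \notin l /\ P k.
Proof.
rewrite /has_colour -[4]/(size (iota 0 4)) -has_find => /hasP[k].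
rewrite mem_iota => k4; case: ifP => // kl Pk.
by exists (Ordinal (k4 : k < 4)); rewrite /= kl.
Qed.

Ltac split_ands := repeat match goal with
  | H : is_true (_ && _) |- _ => let H1 := fresh "N" in case/andP: H => H1 H
  end.

Ltac neq_simpl := repeat match goal with
  | |- context [?x == ?x] => rewrite (eqxx x)
  | H : is_true (~~ (?x == ?y)) |- context [?x == ?y] => rewrite (negPf H)
  | H : is_true (~~ (?x == ?y)) |- context [?y == ?x] => rewrite (eq_sym y x) (negPf H)
  end.

Section Dumbbell.
Variables (T : finType) (e : rel T) (a b v1 v2 v4 v5 c d u1 u2 u3 u4 u5 u6 x : T).
Hypothesis min : in_eMPGN4 e.
Hypothesis U : uniq [:: a; b; v1; v2; v4; v5; c; d; u1; u2; u3; u4; u5; u6].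
Hypothesis Na : forall w, e a w = (w \in [:: b; c; d; v1; v2]).
Hypothesis Nb : forall w, e b w = (w \in [:: a; c; d; v4; v5]).
Hypothesis Nv1 : forall w, e v1 w = (w \in [:: a; v2; d; u1; u2]).
Hypothesis Nv2 : forall w, e v2 w = (w \in [:: a; v1; c; u2; u3]).
Hypothesis Nv4 : forall w, e v4 w = (w \in [:: b; v5; c; u4; u5]).
Hypothesis Nv5 : forall w, e v5 w = (w \in [:: b; v4; d; u5; u6]).
(** Allowing [x] to equal [u3] makes the section cover degree 6 as well as degree 7. *)
Hypothesis Nc : forall w, e c w = (w \in [:: a; b; v2; v4; u3; u4; x]).
Hypothesis xI : x \notin [:: a; b; v1; v2; v4; v5; c].
Hypotheses (du1 : e d u1) (u12 : e u1 u2) (u23 : e u2 u3) (u45 : e u4 u5) (u56 : e u5 u6) (u6d : e u6 d).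

Let I := [set z in [:: a; b; v1; v2; v4; v5; c]].

(** Interior vertices are adjacent only to interior and ring vertices, so seven suitable colours on
    the interior would complete [f] to a 4-colouring of [e]. *)
Lemma not_extendable (f : T -> 'I_4) : proper_on e [predC I] f ->
  ~~ extendable (f d) (f u1) (f u2) (f u3) (f x) (f u4) (f u5) (f u6).
Proof.
move=> fO; apply/negP.
case/has_colourP=> kc [Kc /has_colourP[k2 [K2 /has_colourP[k1 [K1 /has_colourP[ka [Ka
  /has_colourP[k4 [K4 /has_colourP[k5 [K5 /has_colourP[kb [Kb _]]]]]]]]]]]]].
have [[[es ei] con pl nc] _ _] := min.
move: Kc K2 K1 Ka K4 K5 Kb; rewrite !inE !negb_or !val_eqE => Kc K2 K1 Ka K4 K5 Kb.
pose g z := if z == a then ka else if z == b then kb else if z == v1 then k1 else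
  if z == v2 then k2 else if z == v4 then k4 else if z == v5 then k5 else
  if z == c then kc else f z.
have := U; rewrite /= !inE !negb_or => V.
have := xI; rewrite !inE !negb_or => V'.
split_ands.
have ga : g a = ka by rewrite /g eqxx.
have gb : g b = kb by rewrite /g; neq_simpl.
have g1 : g v1 = k1 by rewrite /g; neq_simpl.
have g2 : g v2 = k2 by rewrite /g; neq_simpl.
have g4 : g v4 = k4 by rewrite /g; neq_simpl.
have g5 : g v5 = k5 by rewrite /g; neq_simpl.
have gc : g c = kc by rewrite /g; neq_simpl.
have gd : g d = f d by rewrite /g; neq_simpl.
have gu1 : g u1 = f u1 by rewrite /g; neq_simpl.
have gu2 : g u2 = f u2 by rewrite /g; neq_simpl.
have gu3 : g u3 = f u3 by rewrite /g; neq_simpl.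
have gu4 : g u4 = f u4 by rewrite /g; neq_simpl.
have gu5 : g u5 = f u5 by rewrite /g; neq_simpl.
have gu6 : g u6 = f u6 by rewrite /g; neq_simpl.
have gx : g x = f x by rewrite /g; neq_simpl.
have gO z : z \notin I -> g z = f z.
  by rewrite !inE !negb_or => ?; split_ands; rewrite /g; neq_simpl.
have gI z w : z \in I -> e z w -> g z != g w.
  rewrite inE => zI; move: zI w; rewrite !inE -?orbA.
  do ?[case/orP]; move/eqP-> => w; rewrite ?Na ?Nb ?Nv1 ?Nv2 ?Nv4 ?Nv5 ?Nc !inE -?orbA;
  do ?[case/orP]; move/eqP->; rewrite ?(ga, gb, g1, g2, g4, g5, gc, gd, gu1, gu2, gu3, gu4, gu5, gu6, gx);
  first [assumption | rewrite eq_sym; assumption].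
apply: nc; exists g => z w zw.
have [zI|zI] := boolP (z \in I); first exact: gI.
have [wI|wI] := boolP (w \in I); first by rewrite eq_sym gI // es.
by rewrite !gO // fO.
Qed.

Lemma not_deg6 : x = u3 -> e u3 u4 -> False.
Proof.
move=> xu3 u34; have [[[es ei] con pl nc] _ _] := min.
have := U; rewrite /= !inE !negb_or => V; split_ands.
pose psi z := if (z == a) || (z == c) then d else
  if (z == v1) || (z == v2) then u1 else
  if [|| z == b, z == v4 | z == v5] then u4 else z.
have pa : psi a = d by rewrite /psi; neq_simpl.
have pc : psi c = d by rewrite /psi; neq_simpl.
have p1 : psi v1 = u1 by rewrite /psi; neq_simpl.
have p2 : psi v2 = u1 by rewrite /psi; neq_simpl.
have pb : psi b = u4 by rewrite /psi; neq_simpl.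
have p4 : psi v4 = u4 by rewrite /psi; neq_simpl.
have p5 : psi v5 = u4 by rewrite /psi; neq_simpl.
have pO z : z \notin I -> psi z = z.
  by rewrite !inE !negb_or => ?; split_ands; rewrite /psi; neq_simpl.
have dI : d \notin I by rewrite !inE; neq_simpl.
have u1I : u1 \notin I by rewrite !inE; neq_simpl.
have u2I : u2 \notin I by rewrite !inE; neq_simpl.
have u3I : u3 \notin I by rewrite !inE; neq_simpl.
have u4I : u4 \notin I by rewrite !inE; neq_simpl.
have u5I : u5 \notin I by rewrite !inE; neq_simpl.
have u6I : u6 \notin I by rewrite !inE; neq_simpl.
have st u v : e u v -> psi u = psi v -> connect (fibre_rel e psi) u v.
  by move=> uv /eqP puv; apply: connect1; rewrite /fibre_rel /= uv.
have fibz z : connect (fibre_rel e psi) z (psi z).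
  have [zI|zI] := boolP (z \in I); last by rewrite pO.
  move: zI; rewrite !inE -?orbA; do ?[case/orP]; move/eqP->; rewrite ?(pa, pb, pc, p1, p2, p4, p5).
  - by apply: st; rewrite ?pa ?pO // Na !inE eqxx /= ?orbT.
  - apply: (@connect_trans _ _ v4); first by apply: st; rewrite ?pb ?p4 // Nb !inE eqxx /= ?orbT.
    by apply: st; rewrite ?p4 ?pO // Nv4 !inE eqxx /= ?orbT.
  - by apply: st; rewrite ?p1 ?pO // Nv1 !inE eqxx /= ?orbT.
  - apply: (@connect_trans _ _ v1); first by apply: st; rewrite ?p1 ?p2 // Nv2 !inE eqxx /= ?orbT.
    by apply: st; rewrite ?p1 ?pO // Nv1 !inE eqxx /= ?orbT.
  - by apply: st; rewrite ?p4 ?pO // Nv4 !inE eqxx /= ?orbT.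
  - apply: (@connect_trans _ _ v4); first by apply: st; rewrite ?p4 ?p5 // Nv5 !inE eqxx /= ?orbT.
    by apply: st; rewrite ?p4 ?pO // Nv4 !inE eqxx /= ?orbT.
  - apply: (@connect_trans _ _ a); first by apply: st; rewrite ?pa ?pc // Nc !inE eqxx /= ?orbT.
    by apply: st; rewrite ?pa ?pO // Na !inE eqxx /= ?orbT.
have [|f [fE fP]] := colour_contraction min (connected_fibres_repr es fibz).
  by move=> inj; have := inj a d; rewrite pa pO // => /(_ erefl) ad; move: dI; rewrite -ad !inE eqxx.
have fO : proper_on e [predC I] f.
  move=> u v uI vI uv; apply: fP => //; rewrite !pO //.
  by apply: contraTneq uv => ->; rewrite ei.
have fa : f a = f d by apply: fE; rewrite pa pO.
have fc : f c = f d by apply: fE; rewrite pc pO.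
have f1 : f v1 = f u1 by apply: fE; rewrite p1 pO.
have f2 : f v2 = f u1 by apply: fE; rewrite p2 pO.
have fb : f b = f u4 by apply: fE; rewrite pb pO.
have f5 : f v5 = f u4 by apply: fE; rewrite p5 pO.
have /negP[] := not_extendable fO; rewrite xu3.
have ne z w : f z != f w -> ((f z : nat) == f w) = false by move=> H; apply/negbTE; apply: contraNneq H => /ord_inj ->.
(* The four inequalities that are not ring edges come from the contracted edges [v2 u3], [c u3],
   [b a] and [v5 u6]. *)
have c31 : f u3 != f u1.
  by rewrite eq_sym -f2 fP ?p2 ?pO ?Nv2 ?inE ?eqxx ?orbT //; neq_simpl.
have c3d : f u3 != f d.
  by rewrite eq_sym -fc fP ?pc ?pO ?Nc ?inE ?eqxx ?orbT //; neq_simpl.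
have c4d : f u4 != f d.
  by rewrite -fb -fa fP ?pb ?pa ?Nb ?inE ?eqxx //; neq_simpl.
have c64 : f u6 != f u4.
  by rewrite eq_sym -f5 fP ?p5 ?pO ?Nv5 ?inE ?eqxx ?orbT //; neq_simpl.
have cc u v : u \notin I -> v \notin I -> e u v -> f u != f v by move=> *; apply: fO.
move: (all4P (f d) extendable_deg6) => /=; move/(all4P (f u1)); rewrite ne ?cc //.
move/(all4P (f u2)); rewrite ne ?cc //; move/(all4P (f u3)).
rewrite !inE !ne ?c31 ?c3d ?cc // 1?es //=; move/(all4P (f u4)).
rewrite !inE !ne ?c4d ?cc // 1?es //=; move/(all4P (f u5)); rewrite ne ?cc //.
by move/(all4P (f u6)); rewrite !inE !ne ?c64 ?cc // 1?es.
Qed.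

Lemma interior_connected : {in I &, forall y z, connect (inside e I) y z}.
Proof.
have [[[es ei] _ _ _] _ _] := min.
have hub z : z \in I -> connect (inside e I) a z.
  have aI : a \in I by rewrite !inE eqxx.
  have bI : b \in I by rewrite !inE eqxx orbT.
  have st u v : u \in I -> v \in I -> e u v -> connect (inside e I) u v.
    by move=> uI vI uv; apply/connect1/and3P.
  have ab : connect (inside e I) a b by apply: st; rewrite // Na !inE eqxx.
  move=> zI; move: (zI); rewrite !inE -?orbA; do ?[case/orP]; move/eqP=> z_eq;
    rewrite -> z_eq in *; rewrite ?connect0 //; try by apply: st; rewrite // Na !inE eqxx ?orbT.
  - by apply: connect_trans ab (st _ _ _ _ _); rewrite // Nb !inE eqxx ?orbT.
  - by apply: connect_trans ab (st _ _ _ _ _); rewrite // Nb !inE eqxx ?orbT.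
move=> y z yI zI; apply: connect_trans (hub z zI).
by rewrite inside_sym ?hub //; case: min => -[].
Qed.

(** The hypothesis [x != u1] cannot be recovered from colours, since the exceptional colouring gives
    [x] and [u1] the same colour. *)
Lemma not_deg7 : e u3 x -> e x u4 -> ~~ e d u5 -> x != d -> x != u1 -> x != u5 -> False.
Proof.
move=> u3x xu4 ndu5 xd xu1 xu5; have [[[es ei] con pl nc] _ _] := min.
have := U; rewrite /= !inE !negb_or => V.
have := xI; rewrite !inE !negb_or => V'; split_ands.
pose psi z := if [|| z == u5, z == a | z == v5] then d else if z == v1 then u1 else
  if z == v2 then u3 else if [|| z == b, z == c | z == v4] then x else z.
have pa : psi a = d by rewrite /psi; neq_simpl.
have pu5 : psi u5 = d by rewrite /psi; neq_simpl.
have p5 : psi v5 = d by rewrite /psi; neq_simpl.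
have p1 : psi v1 = u1 by rewrite /psi; neq_simpl.
have p2 : psi v2 = u3 by rewrite /psi; neq_simpl.
have pb : psi b = x by rewrite /psi; neq_simpl.
have pc : psi c = x by rewrite /psi; neq_simpl.
have p4 : psi v4 = x by rewrite /psi; neq_simpl.
have pO z : z \notin I -> z != u5 -> psi z = z.
  by rewrite !inE !negb_or => ? ?; split_ands; rewrite /psi; neq_simpl.
have dI : d \notin I by rewrite !inE; neq_simpl.
have u1I : u1 \notin I by rewrite !inE; neq_simpl.
have u2I : u2 \notin I by rewrite !inE; neq_simpl.
have u3I : u3 \notin I by rewrite !inE; neq_simpl.
have u4I : u4 \notin I by rewrite !inE; neq_simpl.
have u5I : u5 \notin I by rewrite !inE; neq_simpl.
have u6I : u6 \notin I by rewrite !inE; neq_simpl.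
have xI' : x \notin I by rewrite !inE; neq_simpl.
have pd : psi d = d by rewrite pO //; neq_simpl.
have pu1 : psi u1 = u1 by rewrite pO //; neq_simpl.
have pu3 : psi u3 = u3 by rewrite pO //; neq_simpl.
have px : psi x = x by rewrite pO //; neq_simpl.
have st u v : e u v -> psi u = psi v -> connect (fibre_rel e psi) u v.
  by move=> uv /eqP puv; apply: connect1; rewrite /fibre_rel /= uv.
have fibz z : connect (fibre_rel e psi) z (psi z).
  have [->|zu5] := eqVneq z u5.
    rewrite pu5; apply: (@connect_trans _ _ v5).
      by apply: st; rewrite ?pu5 ?p5 // es Nv5 !inE eqxx /= ?orbT.
    by apply: st; rewrite ?p5 ?pd // Nv5 !inE eqxx /= ?orbT.
  have [zI|zI] := boolP (z \in I); last by rewrite pO.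
  have cx : connect (fibre_rel e psi) c x by apply: st; rewrite ?pc ?px // Nc !inE eqxx /= ?orbT.
  move: zI; rewrite !inE -?orbA; do ?[case/orP]; move/eqP->;
    rewrite ?(pa, pb, pc, p1, p2, p4, p5) //.
  - by apply: st; rewrite ?pa ?pd // Na !inE eqxx /= ?orbT.
  - by apply: connect_trans cx; apply: st; rewrite ?pb ?pc // Nb !inE eqxx /= ?orbT.
  - by apply: st; rewrite ?p1 ?pu1 // Nv1 !inE eqxx /= ?orbT.
  - by apply: st; rewrite ?p2 ?pu3 // Nv2 !inE eqxx /= ?orbT.
  - by apply: connect_trans cx; apply: st; rewrite ?p4 ?pc // Nv4 !inE eqxx /= ?orbT.
  - by apply: st; rewrite ?p5 ?pd // Nv5 !inE eqxx /= ?orbT.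
have [|f [fE fP]] := colour_contraction min (connected_fibres_repr es fibz).
  by move=> inj; have := inj a d; rewrite pa pd => /(_ erefl) ad; move: dI; rewrite -ad !inE eqxx.
(* The vertices [d] and [u5] share a class outside the interior, so this depends on [ndu5]. *)
have fO : proper_on e [predC I] f.
  move=> u v uI vI uv; apply: fP => //.
  have uv' : u != v by apply: contraTneq uv => ->; rewrite ei.
  have [uu5|uu5] := eqVneq u u5.
    have vu5 : v != u5 by rewrite -uu5 eq_sym.
    rewrite uu5 pu5 pO //; apply: contraNneq ndu5 => ->; by rewrite -uu5 es.
  have [vu5|vu5] := eqVneq v u5; last by rewrite !pO.
  by rewrite vu5 pu5 pO //; apply: contraNneq ndu5 => <-; rewrite -vu5.
have fu5 : f u5 = f d by apply: fE; rewrite pu5 pd.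
have fa : f a = f d by apply: fE; rewrite pa pd.
have f1 : f v1 = f u1 by apply: fE; rewrite p1 pu1.
have f2 : f v2 = f u3 by apply: fE; rewrite p2 pu3.
have fc : f c = f x by apply: fE; rewrite pc px.
have cc u v : u \notin I -> v \notin I -> e u v -> f u != f v by move=> *; apply: fO.
have ne z w : f z != f w -> ((f z : nat) == f w) = false.
  by move=> H; apply/negbTE; apply: contraNneq H => /ord_inj ->.
(* These inequalities come from the edges [v2 v1], [v2 a], [c a] and, since [u5] has the colour of
   [d], from [u4 u5]. *)
have c31 : f u3 != f u1.
  by rewrite -f2 -f1 fP ?p2 ?p1 ?Nv2 ?inE ?eqxx ?orbT //; neq_simpl.
have c3d : f u3 != f d.
  by rewrite -f2 -fa fP ?p2 ?pa ?Nv2 ?inE ?eqxx //; neq_simpl.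
have cxd : f x != f d.
  by rewrite -fc -fa fP ?pc ?pa ?Nc ?inE ?eqxx //; neq_simpl.
have c4d : f u4 != f d by rewrite -fu5 cc.
have h1 := ne _ _ (cc _ _ dI u1I du1); have h2 := ne _ _ (cc _ _ u1I u2I u12).
have h3 : (f u3 : nat) \in [:: f u2 : nat; f d : nat; f u1 : nat] = false.
  by rewrite !inE !ne ?c31 ?c3d ?cc // es.
have hx : (f x : nat) \in [:: f u3 : nat; f d : nat] = false.
  by rewrite !inE !ne ?cxd ?cc // es.
have h4 : (f u4 : nat) \in [:: f x : nat; f d : nat] = false.
  by rewrite !inE !ne ?c4d ?cc // es.
have h6 := ne _ _ (cc _ _ u6I dI u6d).
have [fx fu4 fu6 un] : [/\ f x = f u1, f u4 = f u2, f u6 = f u2 & uniq [:: f d; f u1; f u2; f u3]].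
  have := not_extendable fO; rewrite fu5.
  move: (all4P (f d) extendable_deg7) => /=; move/(all4P (f u1)); rewrite h1.
  move/(all4P (f u2)); rewrite h2; move/(all4P (f u3)); rewrite h3.
  move/(all4P (f x)); rewrite hx; move/(all4P (f u4)); rewrite h4.
  move/(all4P (f u6)); rewrite h6.
  case/orP=> [->//|/and4P[un /eqP/ord_inj-> /eqP/ord_inj-> /eqP/ord_inj->]] _.
  by split=> //; rewrite -(map_inj_uniq (@ord_inj 4)).
have [AB AC AD BC BD] : [/\ f d != f u1, f d != f u2, f d != f u3, f u1 != f u2 & f u1 != f u3].
  by move: un; rewrite /= !inE !negb_or => ?; split_ands.
have CD : f u2 != f u3 by rewrite cc.
have neqf z w : f z != f w -> z != w by apply: contraNneq => ->.
(* In the exceptional colouring, [u1] is the only other ring position with the colour of [x]. *)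
have xu2 : x != u2 by apply: neqf; rewrite fx.
have xu3 : x != u3 by apply: neqf; rewrite fx.
have xu4' : x != u4 by apply: neqf; rewrite fx fu4.
have xu6 : x != u6 by apply: neqf; rewrite fx fu6.
pose ring := [:: d; u1; u2; u3; x; u4; u5; u6].
have RO : ring_around e I ring.
  split.
  - by rewrite /= du1 u12 u23 u3x xu4 u45 u56 u6d.
  - by rewrite /= !inE; neq_simpl.
  - have hub z w : w \in I -> z \notin I -> e w z -> on_hub e I z.
      by move=> wI zI wz; rewrite /on_hub zI; apply/exists_inP; exists w.
    apply/allP => z; rewrite !inE; do ?[case/orP]; move/eqP->.
    + by apply: (hub _ a) => //; rewrite ?Na !inE eqxx /= ?orbT.
    + by apply: (hub _ v1) => //; rewrite ?Nv1 !inE eqxx /= ?orbT.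
    + by apply: (hub _ v1) => //; rewrite ?Nv1 !inE eqxx /= ?orbT.
    + by apply: (hub _ v2) => //; rewrite ?Nv2 !inE eqxx /= ?orbT.
    + by apply: (hub _ c) => //; rewrite ?Nc !inE eqxx /= ?orbT.
    + by apply: (hub _ v4) => //; rewrite ?Nv4 !inE eqxx /= ?orbT.
    + by apply: (hub _ v4) => //; rewrite ?Nv4 !inE eqxx /= ?orbT.
    + by apply: (hub _ v5) => //; rewrite ?Nv5 !inE eqxx /= ?orbT.
pose K := kempe e [predC I]; pose sw := kempe_swap e [predC I].
have on g al be w v : connect (K g al be) w v -> sw g al be w v = tperm al be (g v).
  by rewrite /sw /kempe_swap => ->.
have off g al be w v : ~~ connect (K g al be) w v -> sw g al be w v = g v.
  by rewrite /sw /kempe_swap => /negPf->.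
have out g al be w v : g v != al -> g v != be -> sw g al be w v = g v.
  by move=> va vb; apply: kempe_swap_out; rewrite !inE negb_or va vb.
have adj g al be v w : e v w -> v \notin I -> w \notin I ->
    g v \in [:: al; be] -> g w \in [:: al; be] -> connect (K g al be) v w.
  by move=> *; apply/connect1/and5P.
have cr k g al be ga de a1 s1 b1 s2 a2 s3 b2 s4 :=
  @kempe_no_crossing _ e I ring k g al be ga de a1 s1 b1 s2 a2 s3 b2 s4
    (conj es ei) con pl interior_connected RO.
have [ek1 ek2 ek3 ek4] : [/\ extendable (f d) (f u1) (f u2) (f u3) (f u1) (f u2) (f d) (f u1),
    extendable (f d) (f u1) (f u2) (f u3) (f u2) (f u1) (f d) (f u2),
    extendable (f d) (f u1) (f u3) (f u2) (f u1) (f u2) (f u3) (f u2) &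
    extendable (f d) (f u1) (f u2) (f u3) (f d) (f u2) (f u3) (f u2)].
  have := all4P (f u3) (all4P (f u2) (all4P (f u1) (all4P (f d) extendable_kempe))).
  have -> : uniq [:: f d : nat; f u1 : nat; f u2 : nat; f u3 : nat].
    by rewrite -[_ :: _]/(map (@nat_of_ord 4) [:: f d; f u1; f u2; f u3]) (map_inj_uniq (@ord_inj 4)).
  by case/and4P.
have uADBC : uniq [:: f d; f u3; f u1; f u2] by rewrite /= !inE; neq_simpl.
have fu5A : f u5 \in [:: f d; f u3] by rewrite fu5 !inE eqxx.
(* [0 1 2 3 1 2 0 2] becomes [0 1 2 3 1 2 0 1]. *)
have [c1|n1] := boolP (connect (K f (f d) (f u3)) u5 d).
  have fu6B : f u6 \in [:: f u1; f u2] by rewrite fu6 !inE eqxx orbT.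
  (* The chain from [u5] to [d] cuts [u6] off from the rest of the ring, so the interchange at [u6]
     changes no other ring vertex. *)
  have o1 := cr 6 f _ _ _ _ u5 [::] u6 [::] d [::] u1 [:: u2; u3; x; u4] erefl uADBC fu5A fu6B c1.
  have o2 := cr 6 f _ _ _ _ u5 [::] u6 [::] d [:: u1] u2 [:: u3; x; u4] erefl uADBC fu5A fu6B c1.
  have o3 := cr 6 f _ _ _ _ u5 [::] u6 [::] d [:: u1; u2; u3] x [:: u4] erefl uADBC fu5A fu6B c1.
  have o4 := cr 6 f _ _ _ _ u5 [::] u6 [::] d [:: u1; u2; u3; x] u4 [::] erefl uADBC fu5A fu6B c1.
  move: (not_extendable (kempe_swap_proper es fO u6I fu6B)); rewrite -/(sw f _ _ u6).
  rewrite (off _ _ _ _ _ o1) (off _ _ _ _ _ o2) (off _ _ _ _ _ o3) (off _ _ _ _ _ o4).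
  rewrite (on _ _ _ _ u6 (connect0 _ _)) (out f _ _ _ d) // (out f _ _ _ u3) 1?eq_sym //.
  rewrite (out f _ _ _ u5) ?fu5 // fu6 tpermR fx fu4.
  by rewrite ek1.
have fxB : f x \in [:: f u1; f u2] by rewrite fx !inE eqxx.
(* [0 1 2 3 1 2 0 2] becomes [0 1 2 3 2 1 0 2]. *)
have [c2|n2] := boolP (connect (K f (f d) (f u3)) u5 u3).
  have c2' : connect (K f (f d) (f u3)) u3 u5 by rewrite kempe_sym.
  have fu3A : f u3 \in [:: f d; f u3] by rewrite !inE eqxx orbT.
  (* The chain from [u3] to [u5] separates [x] and [u4] from [u6], [u1] and [u2]. Being adjacent,
     [x] and [u4] are interchanged together. *)
  have o1 := cr 3 f _ _ _ _ u3 [::] x [:: u4] u5 [::] u6 [:: d; u1; u2] erefl uADBC fu3A fxB c2'.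
  have o2 := cr 3 f _ _ _ _ u3 [::] x [:: u4] u5 [:: u6; d] u1 [:: u2] erefl uADBC fu3A fxB c2'.
  have o3 := cr 3 f _ _ _ _ u3 [::] x [:: u4] u5 [:: u6; d; u1] u2 [::] erefl uADBC fu3A fxB c2'.
  have i4 : connect (K f (f u1) (f u2)) x u4.
    by apply: adj => //; rewrite fu4 !inE eqxx orbT.
  move: (not_extendable (kempe_swap_proper es fO xI' fxB)); rewrite -/(sw f _ _ x).
  rewrite (off _ _ _ _ _ o1) (off _ _ _ _ _ o2) (off _ _ _ _ _ o3).
  rewrite (on _ _ _ _ x (connect0 _ _)) (on _ _ _ _ _ i4) (out f _ _ _ d) //.
  rewrite (out f _ _ _ u3) 1?eq_sym // (out f _ _ _ u5) ?fu5 // fx fu4 tpermL tpermR fu6.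
  by rewrite ek2.
(* [0 1 2 3 1 2 0 2] becomes [0 1 2 3 1 2 3 2]. *)
pose g := sw f (f d) (f u3) u5.
have gO : proper_on e [predC I] g by apply: kempe_swap_proper.
have gd : g d = f d by apply: off.
have gu3 : g u3 = f u3 by apply: off.
have gu1 : g u1 = f u1 by apply: out => //; rewrite eq_sym.
have gu2 : g u2 = f u2 by apply: out => //; rewrite eq_sym.
have gx : g x = f u1 by rewrite -fx; apply: out; rewrite fx // eq_sym.
have gu4 : g u4 = f u2 by rewrite -fu4; apply: out; rewrite fu4 // eq_sym.
have gu6 : g u6 = f u2 by rewrite -fu6; apply: out; rewrite fu6 // eq_sym.
have gu5 : g u5 = f u3 by rewrite /g (on _ _ _ _ u5 (connect0 _ _)) fu5 tpermL.
have gxA : g x \in [:: f d; f u1] by rewrite gx !inE eqxx orbT.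
(* [0 1 2 3 1 2 3 2] becomes [0 1 3 2 1 2 3 2]. *)
have [c3|n3] := boolP (connect (K g (f d) (f u1)) x d).
  have c3' : connect (K g (f d) (f u1)) d x by rewrite kempe_sym.
  have gdA : g d \in [:: f d; f u1] by rewrite gd !inE eqxx.
  have gu3B : g u3 \in [:: f u2; f u3] by rewrite gu3 !inE eqxx orbT.
  (* The chain from [d] to [x] separates [u3] from [u4], [u5] and [u6]; the adjacent [u2] is
     interchanged with [u3]. *)
  have o1 := cr 0 g _ _ _ _ d [:: u1; u2] u3 [::] x [::] u4 [:: u5; u6] erefl un gdA gu3B c3'.
  have o2 := cr 0 g _ _ _ _ d [:: u1; u2] u3 [::] x [:: u4] u5 [:: u6] erefl un gdA gu3B c3'.
  have o3 := cr 0 g _ _ _ _ d [:: u1; u2] u3 [::] x [:: u4; u5] u6 [::] erefl un gdA gu3B c3'.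
  have i4 : connect (K g (f u2) (f u3)) u3 u2.
    by apply: adj => //; rewrite 1?es // gu2 !inE eqxx.
  move: (not_extendable (kempe_swap_proper es gO u3I gu3B)); rewrite -/(sw g _ _ u3).
  rewrite (off _ _ _ _ _ o1) (off _ _ _ _ _ o2) (off _ _ _ _ _ o3).
  rewrite (on _ _ _ _ u3 (connect0 _ _)) (on _ _ _ _ _ i4) (out g _ _ _ d) ?gd //.
  rewrite (out g _ _ _ u1) ?gu1 // (out g _ _ _ x) ?gx //.
  by rewrite gu2 gu3 gu4 gu5 gu6 tpermL tpermR ek3.
(* [0 1 2 3 1 2 3 2] becomes [0 1 2 3 0 2 3 2]. *)
have n4 : ~~ connect (K g (f d) (f u1)) x u1.
  apply: contra n3 => xu; apply: connect_trans xu (adj _ _ _ _ _ _ _ _ _ _) => //.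
  - by rewrite es.
  - by rewrite gu1 !inE eqxx orbT.
  - by rewrite gd !inE eqxx.
move: (not_extendable (kempe_swap_proper es gO xI' gxA)); rewrite -/(sw g _ _ x).
rewrite (off _ _ _ _ _ n3) (off _ _ _ _ _ n4) (on _ _ _ _ x (connect0 _ _)).
rewrite (out g _ _ _ u2) ?gu2 1?eq_sym // (out g _ _ _ u3) ?gu3 1?eq_sym //.
rewrite (out g _ _ _ u4) ?gu4 1?eq_sym // (out g _ _ _ u5) ?gu5 1?eq_sym //.
rewrite (out g _ _ _ u6) ?gu6 1?eq_sym // gd gu1 gx tpermR.
by rewrite ek4.
Qed.
End Dumbbell.

Lemma deg_seq (T : finType) (e : rel T) v l :
  (forall w, e v w = (w \in l)) -> uniq l -> deg e v = size l.
Proof.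
move=> Nv un; rewrite /deg -(card_uniqP un); apply: eq_card => w.
by rewrite inE Nv.
Qed.

(** Since [common_neighbours] yields two distinct vertices, having only two candidates [s] and [t]
    forces both. *)
Lemma common_pair (T : finType) (e : rel T) h p l s t :
  in_eMPGN4 e -> (forall w, e h w = (w \in l)) -> uniq l -> 2 < size l -> p \in l ->
  (forall q, q \in l -> e p q -> q = s \/ q = t) -> e p s /\ e p t.
Proof.
move=> [[sim con _ _] mx _] Nh un sz pl st.
have hp : e h p by rewrite Nh.
have dh : 2 < deg e h by rewrite (deg_seq Nh).
have [q [q' [qq hq hq' pq pq']]] := common_neighbours sim con mx hp dh.
rewrite Nh in hq; rewrite Nh in hq'.
have := st q hq pq; have := st q' hq' pq'.
by case=> E' [] E; move: qq pq pq'; rewrite E E' ?eqxx.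
Qed.

Ltac mem_solve := rewrite ?inE ?eqxx /= ?orbT.

Ltac uniq_solve := rewrite /= !inE; neq_simpl.

Ltac other_solve es Na Nb Nv1 Nv2 Nv4 Nv5 ei :=
  let q := fresh "q" in move=> q; rewrite !inE; do ?[case/orP]; move/eqP->; rewrite ?ei //;
  try solve [by left | by right | rewrite es ?Na ?Nb ?Nv1 ?Nv2 ?Nv4 ?Nv5 !inE; by neq_simpl].

(** The edges of the ring are not given. Each follows from [common_pair] at a vertex of known
    neighbourhood, where all but two candidates are ruled out by the other neighbourhoods. *)
Lemma deg_ge8 (T : finType) (e : rel T) a b v1 v2 v4 v5 c d u1 u2 u3 u4 u5 u6 :
  in_eMPGN4 e -> uniq [:: a; b; v1; v2; v4; v5; c; d; u1; u2; u3; u4; u5; u6] ->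
  (forall w, e a w = (w \in [:: b; c; d; v1; v2])) ->
  (forall w, e b w = (w \in [:: a; c; d; v4; v5])) ->
  (forall w, e v1 w = (w \in [:: a; v2; d; u1; u2])) ->
  (forall w, e v2 w = (w \in [:: a; v1; c; u2; u3])) ->
  (forall w, e v4 w = (w \in [:: b; v5; c; u4; u5])) ->
  (forall w, e v5 w = (w \in [:: b; v4; d; u5; u6])) ->
  7 < deg e c.
Proof.
move=> min U Na Nb Nv1 Nv2 Nv4 Nv5; have [[[es ei] con pl _] _ _] := min.
have := U; rewrite /= !inE !negb_or => V; split_ands.
have [u1d u12] : e u1 d /\ e u1 u2.
  apply: (common_pair min Nv1) => //; [by uniq_solve | by mem_solve |].
  by other_solve es Na Nb Nv1 Nv2 Nv4 Nv5 ei.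
have [u3c u32] : e u3 c /\ e u3 u2.
  apply: (common_pair min Nv2) => //; [by uniq_solve | by mem_solve |].
  by other_solve es Na Nb Nv1 Nv2 Nv4 Nv5 ei.
have [u4c u45] : e u4 c /\ e u4 u5.
  apply: (common_pair min Nv4) => //; [by uniq_solve | by mem_solve |].
  by other_solve es Na Nb Nv1 Nv2 Nv4 Nv5 ei.
have [u6d u65] : e u6 d /\ e u6 u5.
  apply: (common_pair min Nv5) => //; [by uniq_solve | by mem_solve |].
  by other_solve es Na Nb Nv1 Nv2 Nv4 Nv5 ei.
have ac : e c a by rewrite es Na; mem_solve.
have bc : e c b by rewrite es Nb; mem_solve.
have v2c : e c v2 by rewrite es Nv2; mem_solve.
have v4c : e c v4 by rewrite es Nv4; mem_solve.
have cu3 : e c u3 by rewrite es.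
have cu4 : e c u4 by rewrite es.
pose L := [:: a; b; v2; v4; u3; u4].
have Lc w : w \in L -> e c w.
  by rewrite !inE; do ?[case/orP]; move/eqP->.
have uL : uniq L by uniq_solve.
have ge6 : 6 <= deg e c.
  rewrite -[6]/(size L) -(card_uniqP uL); apply: subset_leq_card; apply/subsetP => w.
  by move/Lc; rewrite /nbhd in_set.
rewrite ltnNge; apply/negP => le7.
have cD : #|nbhd e c :\: [set w in L]| = deg e c - 6.
  rewrite cardsD (setIidPr _); last by apply/subsetP => w; rewrite /nbhd !in_set; apply: Lc.
  by congr (_ - _); rewrite cardsE (card_uniqP uL).
have [d6|d7] : deg e c = 6 \/ deg e c = 7 by move: ge6 le7; clear; lia.
  have Nc w : e c w = (w \in [:: a; b; v2; v4; u3; u4; u3]).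
    apply/idP/idP => [cw|]; last first.
      by rewrite !inE; do ?[case/orP]; move/eqP->.
    move: cD; rewrite d6 subnn => /eqP; rewrite cards_eq0 => /eqP/setP/(_ w).
    rewrite /nbhd !in_set cw andbT => /negbFE.
    by rewrite !inE; do ?[case/orP]; move/eqP->; mem_solve.
  have Nc' w : e c w = (w \in L).
    by rewrite Nc !inE; case: (w == u3); rewrite ?orbT ?orbF.
  have [_ u34] : e u3 v2 /\ e u3 u4.
    apply: (common_pair min Nc') => //; [by mem_solve |].
    by other_solve es Na Nb Nv1 Nv2 Nv4 Nv5 ei.
  by apply: (not_deg6 min U Na Nb Nv1 Nv2 Nv4 Nv5 Nc); rewrite // ?inE; neq_simpl; rewrite // es.
have [x xE] : exists x, nbhd e c :\: [set w in L] = [set x].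
  by apply/cards1P; rewrite cD d7.
have Nc w : e c w = (w \in [:: a; b; v2; v4; u3; u4; x]).
  have -> : w \in [:: a; b; v2; v4; u3; u4; x] = (w \in L) || (w == x).
    by rewrite !inE -?orbA.
  have /setP/(_ w) := xE; rewrite /nbhd in_setD !in_set in_set1.
  by case: (boolP (w \in L)) => [/Lc-> //|_ /= ->].
have cx : e c x by rewrite Nc; mem_solve.
have xL : x \notin L.
  have : x \in nbhd e c :\: [set w in L] by rewrite xE set11.
  by rewrite in_setD in_set => /andP[].
have du1 : e d u1 by rewrite es.
have u23 : e u2 u3 by rewrite es.
have u56 : e u5 u6 by rewrite es.
(* The neighbours of a vertex of degree 5 form a cycle without chords. The hubs [a], [v2], [v4] show
   that [x] is none of [d], [u2], [u5]; the hubs [v5] and [v1] give the nonadjacency that the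
   contraction needs, for the dumbbell and for its mirror image. *)
have ncd : ~~ e c d.
  apply: (@no_chord _ e a c b [::] d v1 [:: v2] min); last by rewrite /= !Na; mem_solve.
    by rewrite /= bc Nb (es d) !Nv1 Nv2; mem_solve.
  by uniq_solve.
have ncu2 : ~~ e c u2.
  apply: (@no_chord _ e v2 c u3 [::] u2 v1 [:: a] min); last by rewrite /= !Nv2; mem_solve.
    by rewrite /= cu3 u32 (es u2) !Nv1 Na; mem_solve.
  by uniq_solve.
have ncu5 : ~~ e c u5.
  apply: (@no_chord _ e v4 c u4 [::] u5 v5 [:: b] min); last by rewrite /= !Nv4; mem_solve.
    by rewrite /= cu4 u45 (es u5) !Nv5 Nb; mem_solve.
  by uniq_solve.
have ndu5 : ~~ e d u5.
  apply: (@no_chord _ e v5 d u6 [::] u5 v4 [:: b] min); last by rewrite /= !Nv5; mem_solve.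
    by rewrite /= (es d) u6d u65 (es u5) !Nv4 Nb; mem_solve.
  by uniq_solve.
have ndu2 : ~~ e d u2.
  apply: (@no_chord _ e v1 d u1 [::] u2 v2 [:: a] min); last by rewrite /= !Nv1; mem_solve.
    by rewrite /= du1 u12 (es u2) !Nv2 Na; mem_solve.
  by uniq_solve.
have nx w : ~~ e c w -> x != w by apply: contraNneq => <-.
have xd := nx _ ncd; have xu2 := nx _ ncu2; have xu5 := nx _ ncu5.
have xc : x != c by rewrite nx ?ei.
have xv1 : x != v1 by rewrite nx // es Nv1 !inE; neq_simpl.
have xv5 : x != v5 by rewrite nx // es Nv5 !inE; neq_simpl.
move: xL; rewrite !inE !negb_or => xL; split_ands.
have xI : x \notin [:: a; b; v1; v2; v4; v5; c] by rewrite !inE; neq_simpl.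
have uLx : uniq [:: a; b; v2; v4; u3; u4; x] by uniq_solve.
have [xu3 xu4] : e x u3 /\ e x u4.
  apply: (common_pair min Nc) => //; first by mem_solve.
  by other_solve es Na Nb Nv1 Nv2 Nv4 Nv5 ei.
have u3x : e u3 x by rewrite es.
(* If [x = u1], the reflection exchanging [a] with [b], [v1] with [v5], [v2] with [v4] and reversing
   [u1], ..., [u6] is used. It asks for [x != u6] instead, which now holds. *)
have [xu1|xu1] := eqVneq x u1; last first.
  exact: (not_deg7 min U Na Nb Nv1 Nv2 Nv4 Nv5 Nc xI du1 u12 u23 u45 u56 u6d).
have xu6 : x != u6 by rewrite xu1.
have u4x : e u4 x by rewrite es.
have swap_mem (p q r s t : T) w : (w \in [:: p; q; r; s; t]) = (w \in [:: p; q; r; t; s]).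
  by rewrite !inE [(w == s) || _]orbC.
apply: (@not_deg7 _ e b a v5 v4 v2 v1 c d u6 u5 u4 u3 u2 u1 x min) => //.
- by uniq_solve.
- by move=> w; rewrite Nb swap_mem.
- by move=> w; rewrite Na swap_mem.
- by move=> w; rewrite Nv5 swap_mem.
- by move=> w; rewrite Nv4 swap_mem.
- by move=> w; rewrite Nv2 swap_mem.
- by move=> w; rewrite Nv1 swap_mem.
- move=> w; rewrite Nc !inE.
  by rewrite (orbCA (w == a)) (orbCA (w == v2)) (orbCA (w == u3)).
- by rewrite !inE; neq_simpl.
- by rewrite es.
- by rewrite es.
- by rewrite es.
Qed.

Theorem theorem4p3 (T : finType) (e : rel T)
    (a b v1 v2 v4 v5 c d u1 u2 u3 u4 u5 u6 : T) :
  in_eMPGN4 e ->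
  uniq [:: a; b; v1; v2; v4; v5; c; d; u1; u2; u3; u4; u5; u6] ->
  nbhd e a = [set b; c; d; v1; v2] ->
  nbhd e b = [set a; c; d; v4; v5] ->
  nbhd e v1 = [set a; v2; d; u1; u2] ->
  nbhd e v2 = [set a; v1; c; u2; u3] ->
  nbhd e v4 = [set b; v5; c; u4; u5] ->
  nbhd e v5 = [set b; v4; d; u5; u6] ->
  (8 <= deg e c)%N /\ (8 <= deg e d)%N.
Proof.
move=> min U Na Nb N1 N2 N4 N5.
have N v p q r s t : nbhd e v = [set p; q; r; s; t] ->
    forall w, e v w = (w \in [:: p; q; r; s; t]).
  by move=> /setP Nv w; have := Nv w; rewrite !inE -!orbA.
split; first exact: (deg_ge8 min U (N _ _ _ _ _ _ Na) (N _ _ _ _ _ _ Nb)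
  (N _ _ _ _ _ _ N1) (N _ _ _ _ _ _ N2) (N _ _ _ _ _ _ N4) (N _ _ _ _ _ _ N5)).
have := U; rewrite /= !inE !negb_or => V; split_ands.
(* The reflection exchanging [c] and [d] fixes [a], [b], [u2], [u5] and swaps [v1] with [v2], [v4]
   with [v5], [u1] with [u3], [u4] with [u6]. *)
apply: (@deg_ge8 T e a b v2 v1 v5 v4 d c u3 u2 u1 u6 u5 u4) => //.
- by rewrite /= !inE; neq_simpl.
- by move=> w; rewrite (N _ _ _ _ _ _ Na) !inE (orbCA (w == c)) [(w == v1) || _]orbC.
- by move=> w; rewrite (N _ _ _ _ _ _ Nb) !inE (orbCA (w == c)) [(w == v4) || _]orbC.
- by move=> w; rewrite (N _ _ _ _ _ _ N2) !inE [(w == u2) || _]orbC.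
- by move=> w; rewrite (N _ _ _ _ _ _ N1) !inE [(w == u1) || _]orbC.
- by move=> w; rewrite (N _ _ _ _ _ _ N5) !inE [(w == u5) || _]orbC.
- by move=> w; rewrite (N _ _ _ _ _ _ N4) !inE [(w == u4) || _]orbC.
Qed.
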